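(* For any $q\in\mathbb{C}$, the linear maps $x\mapsto x\,\mathcal{B}^*_n(q)$ and $x\mapsto x\,\mathcal{B}_n(q)$ on $\mathcal{H}_n(q)$ both have characteristic polynomial $$\chi(y,q)=\prod_{j=0}^{n}\big(y-[n-j]_q\big)^{\binom{n}{j}d_j},$$ where $d_j$ is the number of permutations in $\mathfrak{S}_j$ with no fixed points ($d_0=1$). Moreover, whenever $\mathcal{H}_n(q)$ is semisimple, both maps are diagonalizable.
   Context: $\mathcal{H}_n(q)$ is the Type A Iwahori–Hecke algebra over $\mathbb{C}$ with generators $T_{s_1},\dots,T_{s_{n-1}}$ and relations $T_{s_i}^2=(q-1)T_{s_i}+q$, $T_{s_i}T_{s_j}=T_{s_j}T_{s_i}$ for $|i-j|\ge2$, $T_{s_i}T_{s_{i+1}}T_{s_i}=T_{s_{i+1}}T_{s_i}T_{s_{i+1}}$. $\mathcal{B}_n(q)=\sum_{i=1}^{n}T_{s_{n-1}}T_{s_{n-2}}\cdots T_{s_i}$ and $\mathcal{B}^*_n(q)=\sum_{j=1}^{n}T_{s_j}T_{s_{j+1}}\cdots T_{s_{n-1}}$ (empty products equal $1$). $[m]_q=1+q+\dots+q^{m-1}$ for $m>0$ and $[0]_q=0$. $\mathcal{H}_n(q)$ is semisimple exactly when $q\neq0$ and $q$ is not a primitive $k$-th root of unity for any $2\le k\le n$. *)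

(* Defs.v *)
From HB Require Import structures.
From mathcomp Require Import all_boot all_order all_algebra all_fingroup.
From mathcomp Require Import generic_quotient boolp reals complex.

Set Implicit Arguments.
Unset Strict Implicit.
Unset Printing Implicit Defensive.

Import GRing.Theory.
Local Open Scope ring_scope.
Local Open Scope quotient_scope.

(* The algebra H_n(q) is constructed from its presentation: formal            *)
(* noncommutative algebra expressions in the generators, modulo the smallest  *)
(* congruence containing the axioms of unital associative K-algebras and the  *)
(* defining relations. The generator T_{s_i}, 1 <= i <= n - 1, has the index  *)
(* i - 1 in 'I_n.-1.                                                          *)

Inductive hecke_expr (K : Type) (n : nat) : Type :=
| HGen of 'I_n.-1
| HZero
| HOne
| HOpp of hecke_expr K n
| HAdd of hecke_expr K n & hecke_expr K n
| HMul of hecke_expr K n & hecke_expr K n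
| HScale of K & hecke_expr K n.

Arguments HGen {K n}.
Arguments HZero {K n}.
Arguments HOne {K n}.

HB.instance Definition _ K n := gen_eqMixin (hecke_expr K n).
HB.instance Definition _ K n := gen_choiceMixin (hecke_expr K n).

Section HeckeAlgebra.

Variables (K : comNzRingType) (n : nat) (q : K).

Notation E := (hecke_expr K n).
Notation "x ⊕ y" := (HAdd x y) (at level 50, left associativity).
Notation "x ⊗ y" := (HMul x y) (at level 40, left associativity).
Notation "c ⊙ x" := (HScale c x) (at level 40, left associativity).

Inductive hecke_relation : E -> E -> Prop :=
| hecke_quadratic i :
    hecke_relation (HGen i ⊗ HGen i) (((q - 1) ⊙ HGen i) ⊕ (q ⊙ HOne))
| hecke_commutation (i j : 'I_n.-1) : ((i.+2 <= j) || (j.+2 <= i))%N ->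
    hecke_relation (HGen i ⊗ HGen j) (HGen j ⊗ HGen i)
| hecke_braid (i j : 'I_n.-1) : i.+1 = j :> nat ->
    hecke_relation (HGen i ⊗ HGen j ⊗ HGen i) (HGen j ⊗ HGen i ⊗ HGen j).

Inductive hecke_cong : E -> E -> Prop :=
| hc_rel x y : hecke_relation x y -> hecke_cong x y
| hc_refl x : hecke_cong x x
| hc_sym x y : hecke_cong x y -> hecke_cong y x
| hc_trans y x z : hecke_cong x y -> hecke_cong y z -> hecke_cong x z
| hc_opp x x' : hecke_cong x x' -> hecke_cong (HOpp x) (HOpp x')
| hc_add x x' y y' : hecke_cong x x' -> hecke_cong y y' ->
    hecke_cong (x ⊕ y) (x' ⊕ y')
| hc_mul x x' y y' : hecke_cong x x' -> hecke_cong y y' ->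
    hecke_cong (x ⊗ y) (x' ⊗ y')
| hc_scale c x x' : hecke_cong x x' -> hecke_cong (c ⊙ x) (c ⊙ x')
| hc_addA x y z : hecke_cong (x ⊕ (y ⊕ z)) (x ⊕ y ⊕ z)
| hc_addC x y : hecke_cong (x ⊕ y) (y ⊕ x)
| hc_add0 x : hecke_cong (HZero ⊕ x) x
| hc_addN x : hecke_cong (HOpp x ⊕ x) HZero
| hc_mulA x y z : hecke_cong (x ⊗ (y ⊗ z)) (x ⊗ y ⊗ z)
| hc_mul1l x : hecke_cong (HOne ⊗ x) x
| hc_mul1r x : hecke_cong (x ⊗ HOne) x
| hc_mulDl x y z : hecke_cong ((x ⊕ y) ⊗ z) ((x ⊗ z) ⊕ (y ⊗ z))
| hc_mulDr x y z : hecke_cong (x ⊗ (y ⊕ z)) ((x ⊗ y) ⊕ (x ⊗ z))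
| hc_scaleA a b x : hecke_cong (a ⊙ (b ⊙ x)) ((a * b) ⊙ x)
| hc_scale1 x : hecke_cong (1 ⊙ x) x
| hc_scaleDr a x y : hecke_cong (a ⊙ (x ⊕ y)) ((a ⊙ x) ⊕ (a ⊙ y))
| hc_scaleDl x a b : hecke_cong ((a + b) ⊙ x) ((a ⊙ x) ⊕ (b ⊙ x))
| hc_scaleAl a x y : hecke_cong (a ⊙ (x ⊗ y)) ((a ⊙ x) ⊗ y)
| hc_scaleAr a x y : hecke_cong (a ⊙ (x ⊗ y)) (x ⊗ (a ⊙ y)).

Fixpoint hecke_eval (A : algType K) (t : 'I_n.-1 -> A) (x : E) : A :=
  match x with
  | HGen i => t i
  | HZero => 0
  | HOne => 1
  | HOpp x => - hecke_eval t x
  | HAdd x y => hecke_eval t x + hecke_eval t y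
  | HMul x y => hecke_eval t x * hecke_eval t y
  | HScale c x => c *: hecke_eval t x
  end.

Lemma hecke_eval_cong (A : algType K) (t : 'I_n.-1 -> A) :
    (forall x y, hecke_relation x y -> hecke_eval t x = hecke_eval t y) ->
  forall x y, hecke_cong x y -> hecke_eval t x = hecke_eval t y.
Proof.
move=> trel x y; elim=> {x y} //=; try by move=> *; congruence.
- by move=> *; rewrite addrA.
- by move=> *; rewrite addrC.
- by move=> *; rewrite add0r.
- by move=> *; rewrite addNr.
- by move=> *; rewrite mulrA.
- by move=> *; rewrite mul1r.
- by move=> *; rewrite mulr1.
- by move=> *; rewrite mulrDl.
- by move=> *; rewrite mulrDr.
- by move=> *; rewrite scalerA.
- by move=> *; rewrite scale1r.
- by move=> *; rewrite scalerDr.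
- by move=> *; rewrite scalerDl.
- by move=> *; rewrite scalerAl.
- by move=> *; rewrite scalerAr.
Qed.

Definition hecke_congb (x y : E) : bool := `[< hecke_cong x y >].

Lemma hecke_congb_equiv : equiv_class_of hecke_congb.
Proof.
split=> [x|x y|y x z].
- by apply/asboolP; exact: hc_refl.
- by apply/asboolP/asboolP; exact: hc_sym.
- by move=> /asboolP xy /asboolP yz; apply/asboolP; exact: hc_trans xy yz.
Qed.

Canonical hecke_congb_equivRel := EquivRelPack hecke_congb_equiv.

Definition hecke := {eq_quot hecke_congb}.

HB.instance Definition _ := Choice.on hecke.
HB.instance Definition _ := EqQuotient.on hecke.

Definition hecke_pi (x : E) : hecke := \pi_hecke x.

Lemma hecke_piP (x y : E) : hecke_cong x y <-> hecke_pi x = hecke_pi y.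
Proof.
split=> [xy|/eqquotP /asboolP //].
by apply/eqquotP/asboolP.
Qed.

Lemma hecke_piW (P : hecke -> Prop) :
  (forall x, P (hecke_pi x)) -> forall u, P u.
Proof. by move=> Ppi u; rewrite -[u]reprK; exact: Ppi. Qed.

Lemma hecke_repr_pi (x : E) : hecke_cong (repr (hecke_pi x)) x.
Proof. by apply/hecke_piP; rewrite /hecke_pi reprK. Qed.

Definition hecke_zero : hecke := hecke_pi HZero.
Definition hecke_one : hecke := hecke_pi HOne.
Definition hecke_opp (x : hecke) : hecke := hecke_pi (HOpp (repr x)).
Definition hecke_add (x y : hecke) : hecke := hecke_pi (repr x ⊕ repr y).
Definition hecke_mul (x y : hecke) : hecke := hecke_pi (repr x ⊗ repr y).
Definition hecke_scale (c : K) (x : hecke) : hecke := hecke_pi (c ⊙ repr x).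

Lemma hecke_pi_opp x : hecke_opp (hecke_pi x) = hecke_pi (HOpp x).
Proof. by apply/hecke_piP/hc_opp/hecke_repr_pi. Qed.

Lemma hecke_pi_add x y : hecke_add (hecke_pi x) (hecke_pi y) = hecke_pi (x ⊕ y).
Proof. by apply/hecke_piP/hc_add; exact: hecke_repr_pi. Qed.

Lemma hecke_pi_mul x y : hecke_mul (hecke_pi x) (hecke_pi y) = hecke_pi (x ⊗ y).
Proof. by apply/hecke_piP/hc_mul; exact: hecke_repr_pi. Qed.

Lemma hecke_pi_scale c x : hecke_scale c (hecke_pi x) = hecke_pi (c ⊙ x).
Proof. by apply/hecke_piP/hc_scale/hecke_repr_pi. Qed.

Definition hecke_piE :=
  (hecke_pi_opp, hecke_pi_add, hecke_pi_mul, hecke_pi_scale).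

Lemma hecke_addA : associative hecke_add.
Proof.
elim/hecke_piW=> x; elim/hecke_piW=> y; elim/hecke_piW=> z.
by rewrite !hecke_piE; apply/hecke_piP; exact: hc_addA.
Qed.

Lemma hecke_addC : commutative hecke_add.
Proof.
elim/hecke_piW=> x; elim/hecke_piW=> y.
by rewrite !hecke_piE; apply/hecke_piP; exact: hc_addC.
Qed.

Lemma hecke_add0 : left_id hecke_zero hecke_add.
Proof.
by elim/hecke_piW=> x; rewrite !hecke_piE; apply/hecke_piP; exact: hc_add0.
Qed.

Lemma hecke_addN : left_inverse hecke_zero hecke_opp hecke_add.
Proof.
by elim/hecke_piW=> x; rewrite !hecke_piE; apply/hecke_piP; exact: hc_addN.
Qed.

HB.instance Definition _ :=
  GRing.isZmodule.Build hecke hecke_addA hecke_addC hecke_add0 hecke_addN.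

Lemma hecke_mulA : associative hecke_mul.
Proof.
elim/hecke_piW=> x; elim/hecke_piW=> y; elim/hecke_piW=> z.
by rewrite !hecke_piE; apply/hecke_piP; exact: hc_mulA.
Qed.

Lemma hecke_mul1l : left_id hecke_one hecke_mul.
Proof.
by elim/hecke_piW=> x; rewrite !hecke_piE; apply/hecke_piP; exact: hc_mul1l.
Qed.

Lemma hecke_mul1r : right_id hecke_one hecke_mul.
Proof.
by elim/hecke_piW=> x; rewrite !hecke_piE; apply/hecke_piP; exact: hc_mul1r.
Qed.

Lemma hecke_mulDl : left_distributive hecke_mul hecke_add.
Proof.
elim/hecke_piW=> x; elim/hecke_piW=> y; elim/hecke_piW=> z.
by rewrite !hecke_piE; apply/hecke_piP; exact: hc_mulDl.
Qed.

Lemma hecke_mulDr : right_distributive hecke_mul hecke_add.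
Proof.
elim/hecke_piW=> x; elim/hecke_piW=> y; elim/hecke_piW=> z.
by rewrite !hecke_piE; apply/hecke_piP; exact: hc_mulDr.
Qed.

(* H_n(q) is nonzero because of its character T_{s_i} |-> q. *)
Lemma hecke_one_neq0 : hecke_one != 0 :> hecke.
Proof.
apply/eqP=> /hecke_piP /(@hecke_eval_cong K^o (fun=> q)) /= ev.
suff /ev/eqP : forall x y, hecke_relation x y ->
    @hecke_eval K^o (fun=> q) x = @hecke_eval K^o (fun=> q) y.
  by rewrite oner_eq0.
move=> x y [i|i j _|i j _] //=.
by rewrite /GRing.scale /= mulr1 mulrBl mul1r subrK.
Qed.

HB.instance Definition _ :=
  GRing.Zmodule_isNzRing.Build hecke hecke_mulA hecke_mul1l hecke_mul1r
    hecke_mulDl hecke_mulDr hecke_one_neq0.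

Lemma hecke_scaleA a b x :
  hecke_scale a (hecke_scale b x) = hecke_scale (a * b) x.
Proof.
by elim/hecke_piW: x => x; rewrite !hecke_piE; apply/hecke_piP; exact: hc_scaleA.
Qed.

Lemma hecke_scale1 : left_id 1 hecke_scale.
Proof.
by elim/hecke_piW=> x; rewrite !hecke_piE; apply/hecke_piP; exact: hc_scale1.
Qed.

Lemma hecke_scaleDr : right_distributive hecke_scale +%R.
Proof.
move=> a; elim/hecke_piW=> x; elim/hecke_piW=> y; rewrite /GRing.add /=.
by rewrite !hecke_piE; apply/hecke_piP; exact: hc_scaleDr.
Qed.

Lemma hecke_scaleDl x : {morph hecke_scale^~ x : a b / a + b}.
Proof.
elim/hecke_piW: x => x a b; rewrite {2}/GRing.add /=.
by rewrite !hecke_piE; apply/hecke_piP; exact: hc_scaleDl.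
Qed.

HB.instance Definition _ :=
  GRing.Zmodule_isLmodule.Build K hecke hecke_scaleA hecke_scale1
    hecke_scaleDr hecke_scaleDl.

Lemma hecke_scaleAl (a : K) (x y : hecke) : a *: (x * y) = (a *: x) * y.
Proof.
elim/hecke_piW: x => x; elim/hecke_piW: y => y; rewrite /GRing.scale /GRing.mul /=.
by rewrite !hecke_piE; apply/hecke_piP; exact: hc_scaleAl.
Qed.

HB.instance Definition _ :=
  GRing.Lmodule_isLalgebra.Build K hecke hecke_scaleAl.

Lemma hecke_scaleAr (a : K) (x y : hecke) : a *: (x * y) = x * (a *: y).
Proof.
elim/hecke_piW: x => x; elim/hecke_piW: y => y; rewrite /GRing.scale /GRing.mul /=.
by rewrite !hecke_piE; apply/hecke_piP; exact: hc_scaleAr.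
Qed.

HB.instance Definition _ :=
  GRing.Lalgebra_isAlgebra.Build K hecke hecke_scaleAr.

Definition heckeT (i : 'I_n.-1) : hecke := hecke_pi (HGen i).

Lemma heckeT_quadratic i :
  heckeT i * heckeT i = (q - 1) *: heckeT i + q *: 1.
Proof.
transitivity (hecke_add (hecke_scale (q - 1) (heckeT i))
  (hecke_scale q hecke_one)) => //.
rewrite /GRing.mul /= /heckeT /hecke_one.
by rewrite !hecke_piE; apply/hecke_piP/hc_rel/hecke_quadratic.
Qed.

Lemma heckeT_comm (i j : 'I_n.-1) : ((i.+2 <= j) || (j.+2 <= i))%N ->
  heckeT i * heckeT j = heckeT j * heckeT i.
Proof.
move=> ij; rewrite /GRing.mul /= /heckeT.
by rewrite !hecke_piE; apply/hecke_piP/hc_rel/hecke_commutation.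
Qed.

Lemma heckeT_braid (i j : 'I_n.-1) : i.+1 = j :> nat ->
  heckeT i * heckeT j * heckeT i = heckeT j * heckeT i * heckeT j.
Proof.
move=> ij; rewrite /GRing.mul /= /heckeT.
by rewrite !hecke_piE; apply/hecke_piP/hc_rel/hecke_braid.
Qed.

(* The factors of T_{s_{n-1}} ... T_{s_i} come in decreasing order, those of  *)
(* T_{s_j} ... T_{s_{n-1}} in increasing order; like the generators, the      *)
(* summation indices i and j are shifted by one.                              *)
Definition heckeB : hecke :=
  \sum_(i < n) \prod_(k <- rev (enum 'I_n.-1) | (i <= k)%N) heckeT k.

Definition heckeBstar : hecke :=
  \sum_(j < n) \prod_(k <- enum 'I_n.-1 | (j <= k)%N) heckeT k.

End HeckeAlgebra.

Definition rmul (A : nzRingType) (a : A) (x : A) : A := x * a.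

Lemma rmul_is_linear (K : comNzRingType) (A : algType K) (a : A) :
  linear (rmul a).
Proof. by move=> c x y; rewrite /rmul mulrDl scalerAl. Qed.

HB.instance Definition _ (K : comNzRingType) (A : algType K) (a : A) :=
  GRing.isLinear.Build K A A *:%R (@rmul A a) (rmul_is_linear a).

Section Endomorphisms.

Variables (K : fieldType) (V : lmodType K).

Definition is_basis (N : nat) (b : 'I_N -> V) : Prop :=
  forall v : V, exists! c : {ffun 'I_N -> K}, v = \sum_(i < N) c i *: b i.

(* Both notions include the finite-dimensionality of V. As the characteristic *)
(* polynomial is independent of the basis and invariant under transposition,  *)
(* one basis suffices and row i of M can hold the coordinates of f (b i).     *)
Definition has_char_poly (f : {linear V -> V}) (p : {poly K}) : Prop :=
  exists (N : nat) (b : 'I_N -> V) (M : 'M[K]_N),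
    [/\ is_basis b,
        forall i, f (b i) = \sum_(j < N) M i j *: b j
      & char_poly M = p].

Definition is_diagonalizable (f : {linear V -> V}) : Prop :=
  exists (N : nat) (b : 'I_N -> V) (c : 'I_N -> K),
    is_basis b /\ (forall i, f (b i) = c i *: b i).

End Endomorphisms.

Section Semisimplicity.

Variable A : nzRingType.

(* A is semisimple when its left regular module is, i.e. when every left      *)
(* ideal has a complementary left ideal.                                      *)
Definition left_ideal (I : A -> Prop) : Prop :=
  [/\ I 0, forall x y, I x -> I y -> I (x + y)
    & forall a x, I x -> I (a * x)].

Definition semisimple : Prop :=
  forall I, left_ideal I ->
  exists J, [/\ left_ideal J, forall x, I x -> J x -> x = 0
    & forall x, exists y z, [/\ I y, J z & x = y + z]].

End Semisimplicity.

Definition qint (K : nzRingType) (q : K) (m : nat) : K := \sum_(i < m) q ^+ i.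

Definition derangements (j : nat) : nat :=
  #|[set s : 'S_j | [forall i, s i != i]]|.

Definition chi (K : comNzRingType) (n : nat) (q : K) : {poly K} :=
  \prod_(j < n.+1)
    ('X - (qint q (n - j))%:P) ^+ ('C(n, j) * derangements j).

(* Main.v *)
From HB Require Import structures.
Require Import Defs.
From mathcomp Require Import all_boot all_order all_algebra all_fingroup.
From mathcomp Require Import generic_quotient reals complex.
From mathcomp Require Import ring zify.

Set Implicit Arguments.
Unset Strict Implicit.
Unset Printing Implicit Defensive.

Import GRing.Theory.
Local Open Scope ring_scope.

(* Write B_n = 1 + T_{s_{n-1}} B_{n-1}. Induction gives                       *)
(* T_{s_{n-1}} B_{n-1} B_n = q B_{n-1} B_n, hence                             *)
(* p(B_n) B_n = p(1 + q B_{n-1}) B_n for every polynomial p. Therefore B_n is *)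
(* annihilated by the product of the X - [i]_q, i in {0, ..., n-2, n}, and    *)
(* the product of the B_n - [i]_q over i < k is a power of q times            *)
(* B_{n-k+1} ... B_n. For an indeterminate q these roots are distinct, so the *)
(* multiplicities m_i of the [i]_q do not depend on q and can be found at     *)
(* q = 1, where B_{n-k+1} ... B_n has trace n! in the regular representation  *)
(* of S_n: sum_i m_i i(i-1)...(i-k+1) = n! for all k <= n, a triangular       *)
(* system whose solution is m_i = C(n, n-i) d_{n-i}. If H_n(q) is semisimple, *)
(* then every x lies in xH_n(q)x. Taking for x the sum of all T_w shows that  *)
(* [k]_q <> 0 for 0 < k <= n, and a non-commutative triangular representation *)
(* excludes q = 0 when n >= 3. So the roots are distinct and the maps are     *)
(* diagonalizable. B*_n is treated by transposing the regular representation, *)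
(* in which the T_{s_i} are symmetric at q = 1.                               *)

(** * Shuffle elements in an algebra satisfying the Hecke relations *)

(** The argument sketched above rests on a few facts. [shuffle_absorb] and its polynomial form
    [horner_shuffle] are the key identities between consecutive shuffles; iterating the latter
    removes one root at a time and gives [shuffle_annihilated] and [shuffle_falling].
    [hecke_vec_inj] identifies H_n(q) with a space of row vectors on which right multiplication by x
    is the matrix [reg_rep x], so that both claims concern explicit matrices of size n!. Their
    entries are polynomials in q: [family_char_poly] works with an indeterminate q and reads the
    multiplicities off traces at q = 1, supplied by [tr_shuffle_prod] and compared with
    [derangement_moments]. Diagonalizability follows from the distinctness of the roots,
    [semisimple_uniq_roots]. *)

Lemma qint0 (K : nzRingType) (q : K) : qint q 0 = 0.
Proof. by rewrite /qint big_ord0. Qed.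

Lemma qintS (K : nzRingType) (q : K) m : qint q m.+1 = 1 + q * qint q m.
Proof.
rewrite /qint big_ord_recl expr0 big_distrr /=; congr (_ + _).
by apply: eq_bigr => i _; rewrite exprS.
Qed.

Section HeckeGenerators.

Variables (K : comNzRingType) (A : algType K).

(** Indexing by [nat], with relations imposed only below [m], lets all the smaller Hecke algebras
    live in the same [A] without casts, as the inductions need. *)
Definition hecke_gens (q : K) (m : nat) (g : nat -> A) : Prop :=
  [/\ forall i, (i < m)%N -> g i * g i = (q - 1) *: g i + q *: 1,
      forall i j, (i.+1 < j)%N -> (j < m)%N -> g i * g j = g j * g i
    & forall i, (i.+1 < m)%N -> g i * g i.+1 * g i = g i.+1 * g i * g i.+1].

Variables (q : K) (m : nat) (g : nat -> A).

(* The element B_n; g 0 plays the role of T_{s_1}. *)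
Fixpoint shuffle n : A := if n is n'.+1 then 1 + g n'.-1 * shuffle n' else 0.

(* B_{n-k+1} ... B_n; for k = n this is the sum of all the T_w. *)
Fixpoint shuffle_prod n k : A :=
  if n is n'.+1 then if k is k'.+1 then shuffle_prod n' k' * shuffle n else 1
  else 1.

Lemma horner_alg_comm (x y : A) (p : {poly K}) :
  x * y = y * x -> x * horner_alg y p = horner_alg y p * x.
Proof.
move=> xy; elim/poly_ind: p => [|p c IH]; first by rewrite rmorph0 mulr0 mul0r.
rewrite rmorphD rmorphM /= horner_algX horner_algC mulrDr mulrDl mulrA IH.
by rewrite -!mulrA xy -scalerAr -scalerAl mulr1 mul1r.
Qed.

Lemma horner_algMX (y : A) (p : {poly K}) :
  horner_alg y (p * 'X) = horner_alg y p * y.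
Proof. by rewrite rmorphM /= horner_algX. Qed.

Lemma horner_algZ (y : A) c (p : {poly K}) :
  horner_alg y (c *: p) = c *: horner_alg y p.
Proof. by rewrite linearZ /= mulr_algl. Qed.

Hypothesis gP : hecke_gens q m g.

(** [shuffle k] involves only generators [g i] with i + 2 <= k, all at distance at least 2 from
    [j]. *)
Lemma shuffle_comm k j : (k <= j)%N -> (j < m)%N ->
  g j * shuffle k = shuffle k * g j.
Proof.
have [_ gC _] := gP.
elim: k => [|k IH] kj jm /=; first by rewrite mulr0 mul0r.
rewrite mulrDr mulrDl mulr1 mul1r mulrA; congr (_ + _).
case: k IH kj => [|k] IH kj /=; first by rewrite !mulr0 mul0r.
by rewrite -gC ?jm // -mulrA IH ?mulrA // ltnW.
Qed.

Lemma shuffle_absorb k : (k < m)%N ->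
  g k * shuffle k.+1 * shuffle k.+2 = q *: (shuffle k.+1 * shuffle k.+2).
Proof.
have [gQ gC gB] := gP.
elim: k => [|k IH] km.
  rewrite /= mulr0 addr0 !mulr1 mul1r mulrDr mulr1 gQ // scalerDr.
  by rewrite scalerBl scale1r addrA addrC [g 0%N + _]addrC subrK.
have xT : g k.+1 * shuffle k.+1 = shuffle k.+1 * g k.+1 by apply: shuffle_comm.
have yE : shuffle k.+2 = 1 + g k * shuffle k.+1 by [].
have -> : shuffle k.+3 = 1 + g k.+1 * shuffle k.+2 by [].
move: (shuffle k.+2) (shuffle k.+1) yE xT IH => y x yE xT IH.
(* Only the left factor [y] is expanded, as 1 + [g k * x]. The braid relation then brings [g k] next
   to [x * y], where the induction hypothesis absorbs it. *)
have key : g k.+1 * y * (g k.+1 * y) =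
    (q *: y - g k.+1 * y) + q *: (y * (g k.+1 * y)).
  rewrite {1}yE mulrDr mulr1 mulrDl.
  have -> : g k.+1 * (g k * x) * (g k.+1 * y) =
            g k.+1 * g k * g k.+1 * (x * y).
    by rewrite !mulrA -[_ * x * g k.+1]mulrA -xT !mulrA.
  rewrite -gB // mulrA gQ // -[g k * _ * _ * _]mulrA.
  rewrite [g k * (x * y)]mulrA IH ?(ltnW km) //.
  rewrite -scalerAr -[g k * _ * _]mulrA [g k.+1 * (x * y)]mulrA xT.
  rewrite 2!mulrA -mulrA.
  have -> : g k * x = y - 1 by rewrite yE addrC addKr.
  rewrite mulrDl -!scalerAl mul1r mulrBl mul1r scalerBr scalerBl scale1r.
  rewrite [q *: (y * _) - _]addrC addrA; congr (_ + _).
  by rewrite [q *: _ - g _ * _]addrC addrAC addrK addrC.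
rewrite [LHS]mulrDr mulr1 key addrA addrA [g k.+1 * y + q *: y]addrC addrK.
by rewrite mulrDr mulr1 scalerDr.
Qed.

(** Induction on [p] leaves a term in which [g k] stands to the left of a polynomial in B_{k+1}. The
    induction hypothesis on [k] trades this polynomial for one in B_k, which commutes with [g k];
    then [shuffle_absorb] replaces [g k] by q and the trade is undone. *)
Lemma horner_shuffle k p : (k <= m)%N ->
  horner_alg (shuffle k.+1) p * shuffle k.+1 =
  horner_alg (shuffle k) (p \Po (1 + q *: 'X)) * shuffle k.+1.
Proof.
elim: k p => [|k IH] p km; elim/poly_ind: p => [|p c IHp];
  rewrite ?comp_poly0 ?rmorph0 // comp_poly_MXaddC.
  rewrite mulrC !(rmorphD, rmorphM) /= !horner_algX !horner_algC.
  rewrite [LHS]mulrDl [RHS]mulrDl -[in LHS]mulrA IHp linearZ /= horner_algX.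
  by rewrite !mulr0 !addr0 scale1r !mulr1 mul1r.
have yE : shuffle k.+2 = 1 + g k * shuffle k.+1 by [].
have xy := shuffle_absorb km.
have gs : g k * shuffle k = shuffle k * g k by apply: shuffle_comm.
have {}IH p0 := IH p0 (ltnW km).
move: (shuffle k.+2) (shuffle k.+1) yE xy IH IHp => y x yE xy IH IHp.
rewrite mulrC !(rmorphD, rmorphM) /= !horner_algX !horner_algC.
rewrite [LHS]mulrDl [RHS]mulrDl -[in LHS]mulrA IHp; congr (_ + _).
rewrite scale1r linearZ /= horner_algX mulrDr mulr1 [RHS]mulrDl.
rewrite {1}yE mulrDl mul1r; congr (_ + _).
set P := p \Po _; set z := horner_alg x P.
have -> : g k * x * (z * y) = g k * (z * x) * y.
  by rewrite -(horner_alg_comm P (erefl (x * x))) !mulrA.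
rewrite mulr_algl -scalerAr -scalerAl {}IH mulrA.
rewrite (horner_alg_comm _ gs) -!mulrA [g k * _]mulrA xy.
by rewrite [RHS]scalerAr.
Qed.

(** The root n - 1 is missing because no permutation of one point is a derangement. For n <= 1 the
    list is [[:: n]]. *)
Definition shuffle_roots n := n :: iota 0 n.-1.

(** As [i+1]_q = 1 + q [i]_q, the substitution turns X - [i+1]_q into q (X - [i]_q): the roots go
    down by one, in step with the passage from B_{n+1} to B_n in [horner_shuffle]. *)
Lemma comp_prod_qint s :
  (\prod_(i <- s) ('X - (qint q i.+1)%:P)) \Po (1 + q *: 'X) =
  q ^+ size s *: \prod_(i <- s) ('X - (qint q i)%:P).
Proof.
elim: s => [|i s IH]; first by rewrite !big_nil scale1r comp_polyC.
rewrite !big_cons comp_polyM IH comp_polyB comp_polyX comp_polyC qintS exprS.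
by rewrite -!mul_polyC !rmorphD !rmorphM /= rmorph1; ring.
Qed.

(** For n >= 2 the root 0 supplies the factor [shuffle n] that [horner_shuffle] requires, and the
    other roots, lowered by one, are those for n - 1. *)
Lemma shuffle_annihilated n : (n <= m.+1)%N ->
  horner_alg (shuffle n) (\prod_(i <- shuffle_roots n) ('X - (qint q i)%:P)) =
    0.
Proof.
rewrite /shuffle_roots; elim: n => [|[|n] IH] nm.
- by rewrite big_seq1 qint0 subr0 horner_algX.
- rewrite big_seq1 qintS qint0 mulr0 addr0 rmorphB /= horner_algX horner_algC.
  by rewrite mulr0 addr0 scale1r subrr.
rewrite [iota _ _]/= !big_cons qint0 subr0 mulrA [_ * 'X]mulrC -mulrA.
rewrite -(add1n 0) iotaDl big_map.
rewrite -(big_cons _ _ n.+1 (iota 0 n) xpredT (fun i => 'X - (qint q i.+1)%:P)).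
rewrite mulrC horner_algMX horner_shuffle // comp_prod_qint.
rewrite -[(_ :: iota _ _) in X in _ *: X]/(n.+1 :: iota 0 n.+1.-1).
by rewrite horner_algZ IH ?(ltnW nm) // scaler0 mul0r.
Qed.

Lemma shuffle_falling n k : (n <= m.+1)%N -> (k <= n)%N ->
  horner_alg (shuffle n) (\prod_(i <- iota 0 k) ('X - (qint q i)%:P)) =
  q ^+ 'C(k, 2) *: shuffle_prod n k.
Proof.
elim: n k => [|n IH] [|k] nm // kn; try by rewrite big_nil rmorph1 scale1r.
rewrite [iota _ _]/= big_cons qint0 subr0 -(add1n 0) iotaDl big_map.
rewrite mulrC horner_algMX horner_shuffle // comp_prod_qint.
rewrite size_iota horner_algZ IH ?(ltnW nm) // binS bin1 exprD.
by rewrite scalerA -scalerAl mulrC.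
Qed.

Lemma shuffle_prod_comm n j : (n <= j)%N -> (j < m)%N ->
  g j * shuffle_prod n n = shuffle_prod n n * g j.
Proof.
elim: n => [|n IH] nj jm; first by rewrite mulr1 mul1r.
rewrite -[shuffle_prod _ _]/(shuffle_prod n n * shuffle n.+1) mulrA.
by rewrite IH ?(ltnW nj) // -!mulrA shuffle_comm.
Qed.

(** When j + 2 = n, the last two factors are split off: [g j] commutes with the product of the
    earlier ones and is absorbed by B_{n-1} B_n. *)
Lemma gen_symmetrizer n j : (n <= m.+1)%N -> (j.+1 < n)%N ->
  g j * shuffle_prod n n = q *: shuffle_prod n n.
Proof.
elim: n => // n IH nm; rewrite ltnS leq_eqVlt.
rewrite -[shuffle_prod _ _]/(shuffle_prod n n * shuffle n.+1) mulrA.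
case/orP=> [/eqP jn|jn]; last by rewrite IH ?(ltnW nm) // scalerAl.
rewrite -{n IH}jn in nm *.
rewrite -[shuffle_prod _ _]/(shuffle_prod j j * shuffle j.+1) mulrA.
rewrite shuffle_prod_comm // -!(mulrA (shuffle_prod j j)) shuffle_absorb //.
by rewrite [RHS]scalerAr.
Qed.

Lemma shuffle_symmetrizer n k : (n <= m.+1)%N -> (k <= n)%N ->
  shuffle k * shuffle_prod n n = qint q k *: shuffle_prod n n.
Proof.
move=> nm; elim: k => [|k IH] kn; first by rewrite qint0 scale0r mul0r.
rewrite mulrDl mul1r -mulrA IH ?(ltnW kn) // qintS scalerDl scale1r.
case: k IH kn => [|k] _ kn; first by rewrite qint0 mulr0 !scale0r mulr0.
by rewrite -scalerAr gen_symmetrizer // scalerA mulrC.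
Qed.

(** The factors B_1, ..., B_n of the symmetrizer act on it by the scalars [1]_q, ..., [n]_q. *)
Lemma symmetrizer_square n : (n <= m.+1)%N ->
  shuffle_prod n n * shuffle_prod n n =
  (\prod_(i < n) qint q i.+1) *: shuffle_prod n n.
Proof.
move=> nm; suff H k : (k <= n)%N -> shuffle_prod k k * shuffle_prod n n =
    (\prod_(i < k) qint q i.+1) *: shuffle_prod n n by apply: H.
elim: k => [|k IH] kn; first by rewrite big_ord0 scale1r mul1r.
rewrite -[shuffle_prod k.+1 _]/(shuffle_prod k k * shuffle k.+1) -mulrA.
by rewrite shuffle_symmetrizer // -scalerAr IH ?(ltnW kn) // scalerA
  big_ord_recr mulrC.
Qed.

End HeckeGenerators.

(** * Normal forms *)

Section Span.

Variables (K : nzRingType) (V : lmodType K).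

Definition lin_span (s : seq V) (x : V) : Prop :=
  exists c : nat -> K, x = \sum_(i < size s) c i *: s`_i.

Lemma lin_span0 s : lin_span s 0.
Proof. by exists (fun=> 0); rewrite big1 // => i _; rewrite scale0r. Qed.

Lemma lin_spanD s x y : lin_span s x -> lin_span s y -> lin_span s (x + y).
Proof.
move=> [c ->] [d ->]; exists (fun i => c i + d i); rewrite -big_split /=.
by apply: eq_bigr => i _; rewrite scalerDl.
Qed.

Lemma lin_spanZ s a x : lin_span s x -> lin_span s (a *: x).
Proof.
move=> [c ->]; exists (fun i => a * c i); rewrite scaler_sumr.
by apply: eq_bigr => i _; rewrite scalerA.
Qed.

Lemma lin_span_mem s x : x \in s -> lin_span s x.
Proof.
move=> xs; exists (fun i => (i == index x s)%:R).
have ix : (index x s < size s)%N by rewrite index_mem.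
rewrite (bigD1 (Ordinal ix)) //= eqxx scale1r nth_index // big1 ?addr0 //.
by move=> i; rewrite -val_eqE /= => /negPf ->; rewrite scale0r.
Qed.

Lemma lin_span_ind s (P : V -> Prop) :
  P 0 -> (forall x y, P x -> P y -> P (x + y)) ->
  (forall a x, P x -> P (a *: x)) -> (forall x, x \in s -> P x) ->
    forall x, lin_span s x -> P x.
Proof.
move=> P0 PD PZ Ps x [c ->]; elim/big_ind: _ => // i _.
by apply/PZ/Ps/mem_nth.
Qed.

End Span.

Section NormalForms.

Variables (K : comNzRingType) (A : algType K) (q : K) (m : nat) (g : nat -> A).

(* T_{s_k} T_{s_{k-1}} ... with r factors. *)
Fixpoint descending k r : A :=
  if r is r'.+1 then descending k r' * g (k - r)%N else 1.

Fixpoint normal_forms k : seq A :=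
  if k is k'.+1 then
    [seq x * descending k r | x <- normal_forms k', r <- iota 0 k.+1]
  else [:: 1].

Lemma size_normal_forms k : size (normal_forms k) = (k.+1)`!.
Proof.
elim: k => // k IH.
rewrite -[normal_forms _]/(allpairs (fun x r => x * descending k.+1 r)
  (normal_forms k) (iota 0 k.+2)).
by rewrite size_allpairs IH size_iota [in RHS]factS mulnC.
Qed.

Hypothesis gP : hecke_gens q m g.

Lemma descending_commL k r j : (k <= m)%N -> (r <= k)%N -> (j.+1 < k - r)%N ->
  descending k r * g j = g j * descending k r.
Proof.
have [_ gC _] := gP; move=> km.
elim: r => [|r IH] rk jr; first by rewrite mul1r mulr1.
rewrite /= -mulrA -gC ?mulrA ?IH //; lia.
Qed.

(** The braid relation inside the run lowers the index of the generator by one as it passes to the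
    left. *)
Lemma descending_commR k r j : (k <= m)%N -> (r <= k)%N -> (k - r < j < k)%N ->
  descending k r * g j = g j.-1 * descending k r.
Proof.
have [_ gC gB] := gP; move=> km.
elim: r => [|r IH] rk /andP[jr jk]; first by lia.
have [jE|jE] := eqVneq j (k - r)%N; last first.
  rewrite /= -mulrA gC ?mulrA ?IH //; lia.
case: r {IH} rk jr jE => [|r] rk jr jE; first by lia.
rewrite /= -jE; have -> : (k - r.+2)%N = j.-1 by lia.
case: j jE jr jk => [|j] jE jr jk; first by lia.
rewrite /= -[LHS]mulrA -[_ * _ * (_ * _)]mulrA (mulrA (g j.+1)) -gB;
  last by lia.
by rewrite !mulrA descending_commL //; lia.
Qed.

(** Let p = k + 1 - r be the index at which the run of a normal form ends. Then [g j] passes through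
    the run unchanged if j < p - 1, passes with its index lowered if j > p, prolongs the run if j =
    p - 1, and is reduced by the quadratic relation if j = p. In the first two cases the generator
    emerging on the left has index below [k] and is handled by the induction hypothesis. *)
Lemma normal_forms_closed k : (k <= m)%N -> forall j x, (j < k)%N ->
  lin_span (normal_forms k) x -> lin_span (normal_forms k) (x * g j).
Proof.
have [gQ _ _] := gP; elim: k => [|k IH] km j x jk //.
apply: (@lin_span_ind _ _ _ (fun x => lin_span (normal_forms k.+1) (x * g j))).
- by rewrite mul0r; apply: lin_span0.
- by move=> y z sy sz; rewrite mulrDl; apply: lin_spanD.
- by move=> a y sy; rewrite -scalerAl; apply: lin_spanZ.
move=> _ /allpairsP[[y r] /= [ys rk ->]].
have {}rk : (r <= k.+1)%N by move: rk; rewrite -[_ :: _]/(iota 0 k.+2) mem_iota;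
  lia.
have memF z i : z \in normal_forms k -> (i <= k.+1)%N ->
    z * descending k.+1 i \in normal_forms k.+1.
  move=> zs ik; apply/allpairsP; exists (z, i); split=> //=.
  by rewrite -[_ :: _]/(iota 0 k.+2) mem_iota.
have spanF z i : lin_span (normal_forms k) z -> (i <= k.+1)%N ->
    lin_span (normal_forms k.+1) (z * descending k.+1 i).
  move=> sz ik; move: z sz.
  apply: (@lin_span_ind _ _ _ (fun z => lin_span _ (z * descending k.+1 i))).
  - by rewrite mul0r; apply: lin_span0.
  - by move=> a b sa sb; rewrite mulrDl; apply: lin_spanD.
  - by move=> a b sb; rewrite -scalerAl; apply: lin_spanZ.
  by move=> z zs; apply/lin_span_mem/memF.
have spany := lin_span_mem ys.
have spanyg i : (i < k)%N -> lin_span (normal_forms k) (y * g i).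
  by move=> ik; apply: IH => //; apply: ltnW.
have [jr|jr] := ltnP j.+1 (k.+1 - r).
  rewrite -mulrA descending_commL // mulrA; apply: spanF => //.
  by apply: spanyg; lia.
have [jr'|jr'] := ltnP (k.+1 - r) j.
  rewrite -mulrA descending_commR ?jr' // mulrA; apply: spanF => //.
  by apply: spanyg; lia.
have [jE|jE] := eqVneq j.+1 (k.+1 - r)%N.
  have -> : y * descending k.+1 r * g j = y * descending k.+1 r.+1.
    by rewrite /= -mulrA; congr (_ * (_ * g _)); lia.
  by apply: spanF => //; lia.
case: r rk jr jr' jE => [|r] rk jr jr' jE; first by lia.
have {}jE : (k.+1 - r.+1)%N = j by lia.
have dE : descending k.+1 r.+1 = descending k.+1 r * g j by rewrite /= jE.
rewrite dE -2!mulrA gQ; last by lia.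
rewrite !mulrDr -!scalerAr mulr1; apply: lin_spanD; apply: lin_spanZ.
  by rewrite -dE; apply: spanF.
by apply: spanF => //; apply: ltnW.
Qed.

Lemma normal_forms1 k : lin_span (normal_forms k) 1.
Proof.
apply: lin_span_mem; elim: k => [|k IH]; first exact: mem_head.
by apply/allpairsP; exists (1, 0); rewrite mulr1 mem_head.
Qed.

End NormalForms.

(** A version of [heckeT] indexed by [nat], with the default value 0 out of range, to fit
    [hecke_gens]. *)
Definition hecke_gen (K : comNzRingType) n (q : K) (i : nat) : hecke n q :=
  if insub i is Some j then heckeT q j else 0.

(** * The presented algebra: spanning set and universal property *)

Section HeckeAlgebra.

Variables (K : comNzRingType) (n : nat) (q : K).

Lemma hecke_genE (i : 'I_n.-1) : hecke_gen n q i = heckeT q i.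
Proof. by rewrite /hecke_gen valK. Qed.

Lemma hecke_genP : hecke_gens q n.-1 (hecke_gen n q).
Proof.
split=> [i im|i j ij jm|i im].
- by rewrite -[ i ]/(val (Ordinal im)) hecke_genE heckeT_quadratic.
- have im : (i < n.-1)%N by lia.
  rewrite -[ i ]/(val (Ordinal im)) -[j]/(val (Ordinal jm)) !hecke_genE.
  by rewrite heckeT_comm //= ij.
have im' := ltnW im.
have := @heckeT_braid K n q (Ordinal im') (Ordinal im) erefl.
by rewrite -!hecke_genE.
Qed.

(** Induction on an expression for [x], strengthened to: right multiplication by [x] preserves the
    span. A product is then two successive multiplications. *)
Lemma hecke_span (x : hecke n q) :
  lin_span (normal_forms (hecke_gen n q) n.-1) x.
Proof.
set S := lin_span _; rewrite -[x]mul1r;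
  move: (normal_forms1 (hecke_gen n q) n.-1).
move: 1; elim/hecke_piW: x; elim=> [i||  |u IH|u IHu v IHv|u IHu v IHv|c u IH] y
  Sy.
- by rewrite -[hecke_pi _ _]/(heckeT q i) -hecke_genE;
  apply: (normal_forms_closed hecke_genP).
- by rewrite (_ : hecke_pi q HZero = 0) // mulr0; apply: lin_span0.
- by rewrite (_ : hecke_pi q HOne = 1) // mulr1.
- by rewrite -hecke_pi_opp mulrN -scaleN1r; apply: lin_spanZ; apply: IH.
- by rewrite -hecke_pi_add mulrDr; apply: lin_spanD; [apply: IHu|apply: IHv].
- by rewrite -hecke_pi_mul mulrA; apply: IHv; apply: IHu.
- by rewrite -hecke_pi_scale -scalerAr; apply: lin_spanZ; apply: IH.
Qed.

Variables (A : algType K) (g : nat -> A).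
Hypothesis gP : hecke_gens q n.-1 g.

Definition hecke_rep (x : hecke n q) : A :=
  hecke_eval (fun i => g (val i)) (repr x).

Lemma hecke_rep_pi u : hecke_rep (hecke_pi q u) =
  hecke_eval (fun i => g (val i)) u.
Proof.
have [gQ gC gB] := gP.
apply: hecke_eval_cong; last exact: hecke_repr_pi.
move=> x y [i|i j ij|i j ij] /=; first exact: gQ.
- by case/orP: ij => ij; [rewrite gC|rewrite [RHS]gC].
by rewrite -ij gB // ij.
Qed.

Lemma hecke_rep_is_zmod_morphism : zmod_morphism hecke_rep.
Proof.
elim/hecke_piW=> u; elim/hecke_piW=> v.
rewrite -[_ - _]/(hecke_add (hecke_pi q u) (hecke_opp (hecke_pi q v))).
by rewrite hecke_pi_opp hecke_pi_add !hecke_rep_pi.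
Qed.

Lemma hecke_rep_is_monoid_morphism : monoid_morphism hecke_rep.
Proof.
split; first by rewrite -[1]/(hecke_pi q HOne) hecke_rep_pi.
elim/hecke_piW=> u; elim/hecke_piW=> v.
rewrite -[_ * _]/(hecke_mul (hecke_pi q u) (hecke_pi q v)).
by rewrite hecke_pi_mul !hecke_rep_pi.
Qed.

Lemma hecke_rep_is_scalable : scalable hecke_rep.
Proof.
move=> c; elim/hecke_piW=> u.
by rewrite -[_ *: _]/(hecke_scale c (hecke_pi q u)) hecke_pi_scale
  !hecke_rep_pi.
Qed.

(** Taking the proof of the relations as an argument lets the morphism structures be inferred from
    the term [hecke_morph gP]. *)
Definition hecke_morph (_ : hecke_gens q n.-1 g) := hecke_rep.

HB.instance Definition _ :=
  GRing.isZmodMorphism.Build (hecke n q) A (hecke_morph gP)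
    hecke_rep_is_zmod_morphism.
HB.instance Definition _ :=
  GRing.isMonoidMorphism.Build (hecke n q) A (hecke_morph gP)
    hecke_rep_is_monoid_morphism.
HB.instance Definition _ :=
  GRing.isScalable.Build K (hecke n q) A *:%R (hecke_morph gP)
    hecke_rep_is_scalable.

Lemma hecke_morph_gen i : (i < n.-1)%N -> hecke_morph gP (hecke_gen n q i) =
  g i.
Proof.
by move=> im; rewrite -[i in LHS]/(val (Ordinal im)) hecke_genE /hecke_morph
  hecke_rep_pi.
Qed.

End HeckeAlgebra.

Section Shuffles.

(* The element B*_n. *)
Fixpoint coshuffle (A : nzRingType) (g : nat -> A) n : A :=
  if n is n'.+1 then 1 + coshuffle g n' * g n'.-1 else 0.

Lemma shuffleE (K : comNzRingType) (A : algType K) (g : nat -> A) n :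
  shuffle g n = \sum_(i < n) \prod_(k <- rev (iota 0 n.-1) | (i <= k)%N) g k.
Proof.
elim: n => [|n IH]; first by rewrite big_ord0.
rewrite big_ord_recr /= {}IH addrC; congr (_ + _).
  by rewrite big_seq_cond big1 // => i; rewrite mem_rev mem_iota; lia.
case: n => [|n]; first by rewrite big_ord0 mulr0.
rewrite big_distrr; apply: eq_bigr => i _.
rewrite (_ : iota 0 n.+1 = iota 0 n ++ [:: n]); last by rewrite -addn1 iotaD.
rewrite rev_cat big_cons /= ifT //.
by rewrite -ltnS.
Qed.

Lemma coshuffleE (A : nzRingType) (g : nat -> A) n :
  coshuffle g n = \sum_(i < n) \prod_(k <- iota 0 n.-1 | (i <= k)%N) g k.
Proof.
elim: n => [|n IH]; first by rewrite big_ord0.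
rewrite big_ord_recr /= {}IH addrC; congr (_ + _).
  by rewrite big_seq_cond big1 // => i; rewrite mem_iota; lia.
case: n => [|n]; first by rewrite big_ord0 mul0r.
rewrite big_distrl; apply: eq_bigr => i _.
rewrite (_ : iota 0 n.+1 = iota 0 n ++ [:: n]); last by rewrite -addn1 iotaD.
rewrite big_cat big_cons big_nil /= ifT ?mulr1 //.
by rewrite -ltnS.
Qed.

Lemma heckeB_shuffle (K : comNzRingType) n (q : K) :
  heckeB n q = shuffle (hecke_gen n q) n.
Proof.
rewrite shuffleE; apply: eq_bigr => i _.
rewrite -val_enum_ord -map_rev big_map; apply: eq_bigr => k _.
by rewrite hecke_genE.
Qed.

Lemma heckeBstar_coshuffle (K : comNzRingType) n (q : K) :
  heckeBstar n q = coshuffle (hecke_gen n q) n.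
Proof.
rewrite coshuffleE; apply: eq_bigr => i _.
rewrite -val_enum_ord big_map; apply: eq_bigr => k _.
by rewrite hecke_genE.
Qed.

End Shuffles.

(** * The regular representation *)

Section RegularRepresentation.

Variables (m : nat).

(** The matrix size (m+1)! is written as a successor so that square matrices carry their ring
    structure. *)
Notation N := ((m.+1)`!.-1).

Lemma card_perm_pred : #|{perm 'I_m.+1}| = N.+1.
Proof. by rewrite card_Sn prednK // fact_gt0. Qed.

Definition perm_rank (w : 'S_m.+1) : 'I_N.+1 :=
  cast_ord card_perm_pred (enum_rank w).

Definition perm_val (i : 'I_N.+1) : 'S_m.+1 :=
  enum_val (cast_ord (esym card_perm_pred) i).

Lemma perm_rankK : cancel perm_rank perm_val.
Proof. by move=> w; rewrite /perm_val /perm_rank cast_ordK enum_rankK. Qed.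

Lemma perm_valK : cancel perm_val perm_rank.
Proof. by move=> i; rewrite /perm_val /perm_rank enum_valK cast_ordKV. Qed.

Lemma perm_rank_inj : injective perm_rank.
Proof. exact: can_inj perm_rankK. Qed.

Variables (K : comNzRingType).

Definition perm_vec (w : 'S_m.+1) : 'rV[K]_N.+1 := delta_mx 0 (perm_rank w).

Lemma perm_vec_mul w n (M : 'M[K]_(_, n)) : perm_vec w *m M =
  row (perm_rank w) M.
Proof. by rewrite rowE. Qed.

Lemma eq_perm_vec_mul n (X Y : 'M[K]_(_, n)) :
  (forall w, perm_vec w *m X = perm_vec w *m Y) -> X = Y.
Proof.
move=> XY; apply/row_matrixP => i.
by have := XY (perm_val i); rewrite !perm_vec_mul perm_valK.
Qed.

Variable q : K.

(* As (tperm a b * w) x = w (tperm a b x), the product w s of the literature  *)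
(* is written s * w here.                                                     *)
Definition swap_mx (a b : 'I_m.+1) : 'M[K]_N.+1 :=
  \matrix_i (let w := perm_val i in let v := perm_vec (tperm a b * w)%g in
    if (w a < w b)%N then v else (q - 1) *: perm_vec w + q *: v).

Lemma perm_vec_swap w a b : perm_vec w *m swap_mx a b =
  if (w a < w b)%N then perm_vec (tperm a b * w)%g
  else (q - 1) *: perm_vec w + q *: perm_vec (tperm a b * w)%g.
Proof. by rewrite perm_vec_mul rowK perm_rankK. Qed.

Lemma tperm_mulK (a b : 'I_m.+1) w : (tperm a b * (tperm a b * w) = w)%g.
Proof. by rewrite mulgA tperm2 mul1g. Qed.

Lemma ltn_permC (w : 'S_m.+1) a b : a != b -> (w b < w a)%N = ~~ (w a < w b)%N.
Proof. by rewrite -(inj_eq (@perm_inj _ w)) -val_eqE /=; lia. Qed.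

Lemma swap_mx_quadratic a b : a != b ->
  swap_mx a b * swap_mx a b = (q - 1) *: swap_mx a b + q *: 1.
Proof.
move=> ab; apply: eq_perm_vec_mul => w.
rewrite mulmxA mulmxDr -!scalemxAr mulmx1 !perm_vec_swap.
case: ifP => wab; rewrite ?mulmxDl -?scalemxAl !perm_vec_swap;
  by rewrite !permM !tpermL !tpermR tperm_mulK (ltn_permC w ab) wab.
Qed.

Lemma swap_mx_comm a b c d : uniq [:: a; b; c; d] ->
  swap_mx a b * swap_mx c d = swap_mx c d * swap_mx a b.
Proof.
rewrite /= !inE !negb_or => /and4P[/and3P[ab ac ad] /andP[bc bd] cd _].
have sC w : (tperm c d * (tperm a b * w) = tperm a b * (tperm c d * w))%g.
  have := tpermJ c d (tperm a b); rewrite /conjg tpermV !tpermD // => {2}<-.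
  by rewrite -!mulgA tperm_mulK.
apply: (@eq_perm_vec_mul N.+1) => w; rewrite !mulmxA !perm_vec_swap.
case: ifP => wab; case: ifP => wcd; rewrite ?mulmxDl -?scalemxAl !perm_vec_swap;
  rewrite !permM ?tpermD // 1?eq_sym // ?wab ?wcd ?sC //.
rewrite !scalerDr !scalerA; apply/rowP => i; rewrite !mxE.
by ring.
Qed.

Lemma swap_mx_braid a b c : uniq [:: a; b; c] ->
  swap_mx a b * swap_mx b c * swap_mx a b =
    swap_mx b c * swap_mx a b * swap_mx b c.
Proof.
rewrite /= !inE !negb_or => /and3P[/andP[ab ac] bc _].
have [ba cb ca] : [/\ b != a, c != b & c != a] by rewrite !(eq_sym b)
  !(eq_sym c).
have sts w : (tperm a b * (tperm b c * (tperm a b * w)) =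
              tperm b c * (tperm a b * (tperm b c * w)))%g.
  have := tpermJ a b (tperm b c); have := tpermJ b c (tperm a b).
  rewrite /conjg !tpermV !tpermL !tpermR (tpermD ac bc) (tpermD ba ca).
  by rewrite !mulgA => -> ->.
apply: (@eq_perm_vec_mul N.+1) => w; rewrite !mulmxA.
have := ltn_permC w ab; have := ltn_permC w bc; have := ltn_permC w ac.
(* The relative order of the three values decides every branch of the six swaps; inconsistent orders
   are discarded. *)
case wab: (w a < w b)%N; case wbc: (w b < w c)%N; case wac: (w a < w c)%N;
  try lia; move=> wca wcb wba.
all: do !rewrite !(mulmxDl, =^~ scalemxAl, perm_vec_swap, permM, tpermL, tpermR,
  tpermD ac bc, tpermD ba ca, tperm_mulK, wab, wbc, wac, wca, wcb, wba) //=.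
all: rewrite ?sts //.
all: rewrite !scalerDr !scalerA; apply/rowP => i; rewrite !mxE.
all: by ring.
Qed.

Definition reg_gen (k : nat) : 'M[K]_N.+1 := swap_mx (inord k) (inord k.+1).

Lemma inord_neq i j : (i <= m)%N -> (j <= m)%N -> i != j ->
  inord i != inord j :> 'I_m.+1.
Proof. by move=> im jm; rewrite -val_eqE /= !inordK. Qed.

Lemma reg_genP : hecke_gens q m reg_gen.
Proof.
split=> [i im|i j ij jm|i im].
- by apply: swap_mx_quadratic; apply: inord_neq; lia.
- apply: swap_mx_comm; rewrite /= !inE !negb_or.
  by rewrite !inord_neq //; lia.
apply: swap_mx_braid; rewrite /= !inE !negb_or.
by rewrite !inord_neq //; lia.
Qed.

(** The defining relations read the same backwards. Through [coshuffle_reg_gen], results on shuffles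
    thus transfer to B*_n by transposition. *)
Lemma reg_gen_trP : hecke_gens q m (fun k => (reg_gen k)^T).
Proof.
have [gQ gC gB] := reg_genP.
have trM (X Y : 'M[K]_N.+1) : X^T * Y^T = (Y * X)^T by rewrite [RHS]trmx_mul.
split=> [i im|i j ij jm|i im]; rewrite !trM.
- by rewrite gQ // linearD !linearZ /= trmx1.
- by rewrite [in RHS]gC.
by rewrite !mulrA gB.
Qed.

Lemma coshuffle_reg_gen n :
  coshuffle reg_gen n = (shuffle (fun k => (reg_gen k)^T) n)^T.
Proof.
elim: n => [|n IH]; first by rewrite /= trmx0.
by rewrite /= IH linearD /= trmx1 trmx_mul trmxK.
Qed.

Definition supp (P : pred 'S_m.+1) (v : 'rV[K]_N.+1) : Prop :=
  forall w, ~~ P w -> v 0 (perm_rank w) = 0.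

Lemma suppD P u v : supp P u -> supp P v -> supp P (u + v).
Proof. by move=> Pu Pv w Pw; rewrite mxE Pu // Pv // addr0. Qed.

Lemma suppZ P a v : supp P v -> supp P (a *: v).
Proof. by move=> Pv w Pw; rewrite mxE Pv // mulr0. Qed.

Lemma supp0 P : supp P 0.
Proof. by move=> w _; rewrite mxE. Qed.

Lemma supp_perm_vec (P : pred 'S_m.+1) w : P w -> supp P (perm_vec w).
Proof.
move=> Pw u Pu; rewrite mxE /= (inj_eq perm_rank_inj).
by case: eqP Pu => // ->; rewrite Pw.
Qed.

Lemma suppW (P Q : pred 'S_m.+1) v : subpred P Q -> supp P v -> supp Q v.
Proof. by move=> PQ Pv w Qw; apply: Pv; apply: contra Qw; apply: PQ. Qed.

Lemma supp_mulmx (P Q : pred 'S_m.+1) v X :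
  (forall w, P w -> supp Q (perm_vec w *m X)) -> supp P v -> supp Q (v *m X).
Proof.
move=> PQ Pv w Qw; rewrite mxE big1 // => i _.
case Pi: (P (perm_val i)); last by rewrite -(perm_valK i) Pv ?mul0r // Pi.
have := PQ _ Pi w Qw; rewrite perm_vec_mul mxE perm_valK => ->.
by rewrite mulr0.
Qed.

Lemma supp_swap (P : pred 'S_m.+1) v a b :
  (forall w, P w -> P (tperm a b * w)%g) -> supp P v ->
    supp P (v *m swap_mx a b).
Proof.
move=> Pt; apply: supp_mulmx => w Pw; rewrite perm_vec_swap.
by case: ifP => _; [|apply: suppD; apply: suppZ]; apply/supp_perm_vec;
  rewrite ?Pt.
Qed.

Definition gen_stable n (P : pred 'S_m.+1) : Prop := forall j w,
  (j.+1 < n)%N -> P w -> P (tperm (inord j) (inord j.+1) * w)%g.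

Lemma supp_shuffle n (P : pred 'S_m.+1) v :
  gen_stable n P -> supp P v -> supp P (v *m shuffle reg_gen n).
Proof.
elim: n v => [|n IH] v st Pv; first by rewrite mulmx0; apply: supp0.
rewrite /= mulmxDr mulmx1; apply: suppD => //.
case: n IH st => [|n] IH st; first by rewrite mulr0 mulmx0; apply: supp0.
rewrite mulmxA; apply: IH; first by move=> j w jn; apply: st; apply: ltnW.
by apply: supp_swap => // w; apply: st.
Qed.

(** The standard copy of the symmetric group on n letters. *)
Definition fix_above n : pred 'S_m.+1 :=
  fun w => [forall x : 'I_m.+1, (n <= x)%N ==> (w x == x)].

Lemma fix_aboveP n (w : 'S_m.+1) :
  reflect (forall x : 'I_m.+1, (n <= x)%N -> w x = x) (fix_above n w).
Proof.
by apply: (iffP 'forall_implyP) => H x nx; apply/eqP; apply: H.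
Qed.

Lemma fix_aboveS n : subpred (fix_above n) (fix_above n.+1).
Proof. by move=> w /fix_aboveP H; apply/fix_aboveP => x nx; apply/H/ltnW. Qed.

Lemma tperm_inord j k : (j < m)%N -> (k <= m)%N -> (j.+1 < k)%N || (k < j)%N ->
  tperm (inord j) (inord j.+1) (inord k) = inord k :> 'I_m.+1.
Proof. by move=> jm km jk; rewrite tpermD // inord_neq //; lia. Qed.

Lemma gen_stable_fix n : (n <= m.+1)%N -> gen_stable n (fix_above n).
Proof.
move=> nm j w jn /fix_aboveP H; apply/fix_aboveP => x nx; rewrite permM.
have xm := ltn_ord x.
rewrite -(inord_val x) tperm_inord ?inord_val ?H //; lia.
Qed.

Lemma supp_shuffle_prod n k : (n <= m.+1)%N ->
  supp (fix_above n) (perm_vec 1%g *m shuffle_prod reg_gen n k).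
Proof.
elim: n k => [|n IH] [|k] nm;
  try by rewrite mulmx1; apply: supp_perm_vec; apply/fix_aboveP => x _;
    rewrite perm1.
rewrite -[shuffle_prod _ _ _]/(shuffle_prod reg_gen n k * shuffle reg_gen n.+1).
rewrite mulmxA; apply: supp_shuffle; first exact: gen_stable_fix.
by apply: suppW (IH k (ltnW nm)); apply: fix_aboveS.
Qed.

Lemma fix_above_lt n (w : 'S_m.+1) (x : 'I_m.+1) : fix_above n w -> (x < n)%N ->
  (w x < n)%N.
Proof.
move=> /fix_aboveP H xn; rewrite ltnNge; apply/negP => nw.
by move: (H _ nw) => /perm_inj wx; move: nw; rewrite wx leqNgt xn.
Qed.

(** All terms of B_{n+1} - 1 begin with the generator exchanging the points n - 1 and n. It sends
    permutations fixing n to permutations moving n, and the generators that follow never touch n, so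
    the identity is not reached again. *)
Lemma shuffle_coef1 n v : (n <= m)%N -> supp (fix_above n) v ->
  (v *m shuffle reg_gen n.+1) 0 (perm_rank 1) = v 0 (perm_rank 1).
Proof.
move=> nm Fv; rewrite /= mulmxDr mulmx1 mxE -[RHS]addr0; congr (_ + _).
case: n nm Fv => [|n] nm Fv; first by rewrite mulr0 mulmx0 mxE.
pose Q : pred 'S_m.+1 := fun w => w (inord n.+1) != inord n.+1.
rewrite mulmxA; apply: (supp_shuffle (P := Q)); last by rewrite /Q perm1 eqxx.
  move=> j w jn; rewrite /Q permM tperm_inord //; lia.
apply: supp_mulmx Fv => w Fw; rewrite perm_vec_swap.
have wn : w (inord n.+1) = inord n.+1 by apply: (fix_aboveP _ _ Fw);
  rewrite inordK.
have wl : (w (inord n) < n.+1)%N by apply: fix_above_lt => //;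
  rewrite inordK // ltnW.
rewrite wn inordK // wl; apply: supp_perm_vec.
by rewrite /Q permM tpermR -val_eqE /= inordK // neq_ltn wl.
Qed.

Lemma shuffle_prod_coef1 n k : (n <= m.+1)%N ->
  shuffle_prod reg_gen n k (perm_rank 1) (perm_rank 1) = 1.
Proof.
suff H : (n <= m.+1)%N -> (perm_vec 1%g *m shuffle_prod reg_gen n k) 0
  (perm_rank 1) = 1.
  by move=> nm; rewrite -(H nm) perm_vec_mul mxE.
elim: n k => [|n IH] [|k] nm; try by rewrite mulmx1 mxE !eqxx.
rewrite -[shuffle_prod _ _ _]/(shuffle_prod reg_gen n k * shuffle reg_gen n.+1).
rewrite mulmxA shuffle_coef1 ?IH //; first exact: ltnW.
by apply: supp_shuffle_prod; apply: ltnW.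
Qed.

(** A bubble sort that uses only length-increasing steps: there [reg_gen] acts by a plain product of
    permutations, so the statement holds for every q, including 0. *)
Lemma perm_vec_reachable (P : 'rV[K]_N.+1 -> Prop) :
  P (perm_vec 1%g) -> (forall v k, (k < m)%N -> P v -> P (v *m reg_gen k)) ->
  forall w, P (perm_vec w).
Proof.
move=> P1 Pg.
suff H n : (n <= m.+1)%N -> forall w, fix_above n w -> P (perm_vec w).
  move=> w; apply: (H m.+1) => //; apply/fix_aboveP => x.
  by rewrite leqNgt ltn_ord.
elim: n => [|n IH] nm w Fw.
  by rewrite (_ : w = 1%g) //; apply/permP => x;
    rewrite perm1 (fix_aboveP _ _ Fw).
(* Here [d] is the distance from the preimage of n to n itself; at distance 0 the permutation fixes
   n and the outer induction applies. *)
suff {w Fw} H d w : (d <= n)%N -> fix_above n.+1 w -> w (inord (n - d)) =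
  inord n ->
    P (perm_vec w).
  have wn : (w^-1%g (inord n) <= n)%N.
    rewrite leqNgt; apply/negP => nw; have := fix_aboveP _ _ Fw _ nw.
    by rewrite permKV => E; move: nw; rewrite -E inordK // ltnn.
  apply: (H (n - w^-1%g (inord n))%N) => //; first exact: leq_subr.
  by rewrite subKn // inord_val permKV.
elim: d w => [|d IHd] w dn Fw wd.
  apply: IH; first exact: ltnW.
  apply/fix_aboveP => x; rewrite leq_eqVlt => /orP[/eqP nx|]; last first.
    exact: fix_aboveP.
  by move: wd; rewrite subn0 nx inord_val.
set p := (n - d.+1)%N in wd; have pS : (n - d)%N = p.+1 by lia.
set u := (tperm (inord p) (inord p.+1) * w)%g.
have Fu : fix_above n.+1 u by apply: gen_stable_fix => //; lia.
have pp : inord p != inord p.+1 :> 'I_m.+1 by apply: inord_neq; lia.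
have up : u (inord p.+1) = inord n by rewrite permM tpermR.
have ulp : (u (inord p) < n)%N.
  rewrite ltn_neqAle -ltnS (fix_above_lt Fu) ?andbT; last by rewrite inordK;
    lia.
  by rewrite -[X in _ != X](@inordK m) // val_eqE -up (inj_eq perm_inj).
have Pu : P (perm_vec u) by apply: IHd => //; rewrite ?pS // ltnW.
have pm : (p < m)%N by lia.
have := Pg _ p pm Pu.
by rewrite perm_vec_swap tperm_mulK up inordK // ulp.
Qed.

End RegularRepresentation.

(** * Specialization of q: symmetry and traces at q = 1, base change *)

Section SpecializationOne.

Variables (m : nat) (K : comNzRingType).

Notation N := ((m.+1)`!.-1).

(** At q = 1 the generators multiply permutations on the left, hence commute with right
    translations. The diagonal of such a matrix is constant, so its trace is (m+1)! times its entry
    at the identity. *)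
Definition right_invariant (X : 'M[K]_N.+1) : Prop := forall u w w' : 'S_m.+1,
  X (perm_rank (w * u)%g) (perm_rank (w' * u)%g) =
    X (perm_rank w) (perm_rank w').

Lemma right_invariant1 : right_invariant 1.
Proof. by move=> u w w'; rewrite !mxE !(inj_eq (@perm_rank_inj m))
  (inj_eq (mulIg u)). Qed.

Lemma right_invariant0 : right_invariant 0.
Proof. by move=> u w w'; rewrite !mxE. Qed.

Lemma right_invariantD X Y :
  right_invariant X -> right_invariant Y -> right_invariant (X + Y).
Proof. by move=> iX iY u w w'; rewrite !mxE iX iY. Qed.

Lemma right_invariantM X Y :
  right_invariant X -> right_invariant Y -> right_invariant (X * Y).
Proof.
move=> iX iY u w w'; rewrite !mxE.
pose h v i := perm_rank (perm_val i * v)%g : 'I_N.+1.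
rewrite (reindex (h u)) /=; last first.
  by exists (h u^-1%g) => i _; rewrite /h perm_rankK ?mulgK ?mulgKV perm_valK.
by apply: eq_bigr => i _; rewrite /h iX iY perm_valK.
Qed.

Lemma swap_mx1E a b w w' :
  swap_mx (1 : K) a b (perm_rank w) (perm_rank w') =
    (w' == tperm a b * w :> 'S_m.+1)%g%:R.
Proof.
rewrite mxE /= perm_rankK subrr scale0r add0r scale1r if_same mxE eqxx /=.
by rewrite (inj_eq (@perm_rank_inj m)).
Qed.

Lemma right_invariant_gen k : right_invariant (reg_gen m (1 : K) k).
Proof.
by move=> u w w'; rewrite !swap_mx1E mulgA (inj_eq (mulIg u)).
Qed.

Lemma right_invariant_shuffle n :
  right_invariant (shuffle (reg_gen m (1 : K)) n).
Proof.
elim: n => [|n IH]; first exact: right_invariant0.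
apply: right_invariantD; first exact: right_invariant1.
by apply: right_invariantM => //; apply: right_invariant_gen.
Qed.

Lemma right_invariant_shuffle_prod n k :
  right_invariant (shuffle_prod (reg_gen m (1 : K)) n k).
Proof.
elim: n k => [|n IH] [|k]; try exact: right_invariant1.
by apply: right_invariantM => //; apply: right_invariant_shuffle.
Qed.

Lemma tr_shuffle_prod n k : (n <= m.+1)%N ->
  \tr (shuffle_prod (reg_gen m (1 : K)) n k) = (m.+1)`!%:R.
Proof.
move=> nm; rewrite /mxtrace.
rewrite (eq_bigr (fun=> 1)) => [|i _].
  by rewrite sumr_const card_ord prednK // fact_gt0.
rewrite -(perm_valK i) -[perm_val i]mul1g right_invariant_shuffle_prod.
exact: shuffle_prod_coef1.
Qed.

Lemma reg_gen_tr k : (reg_gen m (1 : K) k)^T = reg_gen m 1 k.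
Proof.
apply/matrixP => i j; rewrite -(perm_valK i) -(perm_valK j) mxE !swap_mx1E.
congr (nat_of_bool _)%:R; apply/eqP/eqP => ->; by rewrite tperm_mulK.
Qed.

End SpecializationOne.

Section Specialization.

Variables (m : nat) (K L : comNzRingType) (f : {rmorphism K -> L}) (q : K).

(** With q = ['X] over [{poly K}] and [f] an evaluation, a single matrix specializes to every value
    of q. *)
Lemma map_reg_gen k : map_mx f (reg_gen m q k) = reg_gen m (f q) k.
Proof.
apply/matrixP => i j; rewrite !mxE /=.
case: ifP => _; rewrite !mxE ?rmorphD ?rmorphM ?rmorphB ?rmorph1 ?rmorph_nat
  //=.
Qed.

Lemma map_shuffle n :
  map_mx f (shuffle (reg_gen m q) n) = shuffle (reg_gen m (f q)) n.
Proof.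
elim: n => [|n IH]; first by rewrite /= map_mx0.
by rewrite /= map_mxD map_mx1 map_mxM IH map_reg_gen.
Qed.

Lemma map_coshuffle n :
  map_mx f (coshuffle (reg_gen m q) n) = coshuffle (reg_gen m (f q)) n.
Proof.
elim: n => [|n IH]; first by rewrite /= map_mx0.
by rewrite /= map_mxD map_mx1 map_mxM IH map_reg_gen.
Qed.

End Specialization.

(** * Faithfulness of the regular representation and bases of H_n(q) *)

Section HeckeBasis.

Variables (K : fieldType) (n : nat) (q : K).

(* The regular representation is indexed by 'S_n.-1.+1, which covers n = 0. *)
Notation m := n.-1.
Notation N := ((m.+1)`!.-1).

Definition reg_rep : hecke n q -> 'M[K]_N.+1 := hecke_morph (reg_genP m q).

HB.instance Definition _ := GRing.LRMorphism.on reg_rep.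

Definition hecke_vec (x : hecke n q) : 'rV[K]_N.+1 :=
  perm_vec K 1%g *m reg_rep x.

Lemma hecke_vec_is_linear : linear hecke_vec.
Proof.
by move=> a x y; rewrite /hecke_vec linearP mulmxDr -scalemxAr.
Qed.

HB.instance Definition _ :=
  GRing.isLinear.Build K (hecke n q) 'rV[K]_N.+1 *:%R hecke_vec
    hecke_vec_is_linear.

Lemma hecke_vecM x y : hecke_vec (x * y) = hecke_vec x *m reg_rep y.
Proof. by rewrite /hecke_vec rmorphM mulmxA. Qed.

Lemma hecke_vec_surj v : exists x, hecke_vec x = v.
Proof.
have H : forall w, exists x, hecke_vec x = perm_vec K w.
  apply: (@perm_vec_reachable m K q (fun v => exists x, hecke_vec x = v)).
    by exists 1; rewrite /hecke_vec rmorph1 mulmx1.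
  move=> u k km [x <-]; exists (x * hecke_gen n q k).
  by rewrite hecke_vecM [reg_rep (hecke_gen n q k)]hecke_morph_gen.
rewrite (row_sum_delta v).
elim/big_ind: _ => [|_ _ [x <-] [y <-]|i _].
- by exists 0; rewrite linear0.
- by exists (x + y); rewrite linearD.
have [x xE] := H (perm_val i); exists (v 0 i *: x).
by rewrite linearZ /= xE /perm_vec perm_valK.
Qed.

(** A count of dimensions: the normal forms span H_n(q), their number is the dimension of the
    target, and [hecke_vec] is onto. So the matrix [S] of their images is invertible, and a vector
    in the kernel has zero coefficients. *)
Lemma hecke_vec_inj : injective hecke_vec.
Proof.
pose s := normal_forms (hecke_gen n q) m.
have sN : size s = N.+1 by rewrite size_normal_forms (prednK (fact_gt0 _)).
pose S : 'M[K]_N.+1 := \matrix_i hecke_vec s`_i.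
have SP x : exists2 c : nat -> K,
    x = \sum_(i < size s) c i *: s`_i & hecke_vec x = (\row_i c i) *m S.
  have [c xE] := hecke_span x; exists c => //.
  rewrite xE linear_sum /= -/s sN mulmx_sum_row; apply: eq_bigr => i _.
  by rewrite linearZ /= rowK mxE.
have Su : S \in unitmx.
  rewrite -row_full_unit -sub1mx; apply/row_subP => i.
  by have [x <-] := hecke_vec_surj (row i 1%:M); have [c _ ->] := SP x;
    apply: submxMl.
apply: raddf_inj => x vx; have [c xE vE] := SP x.
have cS : (\row_i c i) *m S = 0 by rewrite -vE; exact: vx.
have c0 : \row_(i < N.+1) c i = 0 by rewrite -[LHS](mulmxK Su) cS mul0mx.
rewrite xE sN big1 // => i _.
by have /rowP/(_ i) := c0; rewrite !mxE => ->; rewrite scale0r.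
Qed.

Lemma hecke_basis (P : 'M[K]_N.+1) (b : 'I_N.+1 -> hecke n q) : P \in unitmx ->
  (forall i, hecke_vec (b i) = row i P) -> is_basis b.
Proof.
move=> Pu bP x.
have bE (c : {ffun 'I_N.+1 -> K}) :
    hecke_vec (\sum_i c i *: b i) = (\row_i c i) *m P.
  rewrite linear_sum mulmx_sum_row; apply: eq_bigr => i _.
  by rewrite linearZ /= bP mxE.
exists [ffun i => (hecke_vec x *m invmx P) 0 i]; split.
  apply: hecke_vec_inj; rewrite bE -[LHS](mulmxKV Pu); congr (_ *m _).
  by apply/rowP => i; rewrite [RHS]mxE ffunE.
move=> c ->; apply/ffunP => i; rewrite ffunE bE mulmxK //.
by rewrite mxE.
Qed.

Lemma hecke_vec_rows (P : 'M[K]_N.+1) :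
  exists b : 'I_N.+1 -> hecke n q, forall i, hecke_vec (b i) = row i P.
Proof.
have /fin_all_exists[b bP] : forall i : 'I_N.+1, exists x, hecke_vec x =
  row i P.
  by move=> i; apply: hecke_vec_surj.
by exists b.
Qed.

Lemma has_char_poly_rmul (x : hecke n q) :
  has_char_poly (rmul x) (char_poly (reg_rep x)).
Proof.
have [b bP] := hecke_vec_rows 1%:M.
exists N.+1, b, (reg_rep x); split=> [|i|//].
  exact: (hecke_basis (unitmx1 _ _)).
apply: hecke_vec_inj; rewrite hecke_vecM bP -row_mul mul1mx linear_sum /=.
apply/rowP => k; rewrite summxE mxE (bigD1 k) //= linearZ /= bP !mxE eqxx mulr1.
rewrite big1 ?addr0 // => j jk.
by rewrite linearZ /= bP !mxE (negPf jk) mulr0.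
Qed.

Lemma is_diagonalizable_rmul (x : hecke n q) :
  diagonalizable (reg_rep x) -> is_diagonalizable (rmul x).
Proof.
move=> [P Pu /diagonalizable_forPex[d /(simmxP Pu) PxP]].
have [b bP] := hecke_vec_rows P.
exists N.+1, b, (fun i => d 0 i); split=> [|i]; first exact: (hecke_basis Pu).
apply: hecke_vec_inj; rewrite hecke_vecM bP -row_mul PxP linearZ /= bP.
by rewrite row_mul row_diag_mx -scalemxAl -rowE.
Qed.

End HeckeBasis.

(** * Derangements *)

Section Derangements.

Local Open Scope nat_scope.

Definition perms_moving (T : finType) (A : {set T}) : nat :=
  #|[set s : {perm T} | [set x | s x != x] == A]|.

Lemma sum_perms_moving (T : finType) (A : {set T}) :
  \sum_(B in powerset A) perms_moving B = #|A|`!.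
Proof.
rewrite -card_perm -sum1_card (partition_big
  (fun s : {perm T} => [set x | s x != x])
  (fun B => B \in powerset A)) /=.
  apply: eq_bigr => B; rewrite powersetE => BA.
  rewrite /perms_moving -sum1_card; apply: eq_bigl => s; rewrite inE.
  case: eqP => [sB|_]; last by rewrite andbF.
  rewrite andbT; apply/esym/subsetP => x sx.
  by apply: (subsetP BA); rewrite -sB inE.
by move=> s sA; rewrite powersetE; apply/subsetP => x; rewrite inE =>
  /(subsetP sA).
Qed.

Lemma sum_subsets_card (T : finType) (A : {set T}) (f : nat -> nat) :
  \sum_(B in powerset A) f #|B| = \sum_(j < #|A|.+1) 'C(#|A|, j) * f j.
Proof.
rewrite (partition_big (fun B : {set T} => inord #|B| : 'I_#|A|.+1) xpredT) //=.
apply: eq_bigr => j _.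
rewrite (eq_bigl (fun B => B \in [set B : {set T} | B \subset A & #|B| == j])).
  rewrite (eq_bigr (fun=> f j)) => [|B]; last by rewrite inE =>
    /andP[_ /eqP ->].
  by rewrite sum_nat_const cards_draws.
move=> B; rewrite powersetE inE; apply: andb_id2l => BA.
by rewrite -val_eqE /= inordK // ltnS subset_leq_card.
Qed.

(** All sets of a given cardinality satisfy the same recurrence, in which smaller sets are handled
    by induction. Comparing [A] with the full set of ['I_#|A|] avoids transporting permutations
    along a bijection. *)
Lemma perms_moving_card (T : finType) (A : {set T}) :
  perms_moving A = derangements #|A|.
Proof.
have [k] := ubnP #|A|; elim: k => // k IH in T A *; rewrite ltnS => Ak.
have derE j : derangements j = perms_moving [set: 'I_j].
  rewrite /derangements /perms_moving; apply: eq_card => s; rewrite !inE.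
  apply/forallP/eqP => [sx|/setP sx x]; first by apply/setP => x;
    rewrite !inE sx.
  by have := sx x; rewrite !inE.
have split (U : finType) (B : {set U}) : #|B| = #|A| ->
    #|A|`! = perms_moving B + \sum_(j < #|A|) 'C(#|A|, j) * derangements j.
  move=> BA; rewrite -BA -sum_perms_moving (bigD1 B) /= ?powersetE //.
  congr (_ + _).
  have := sum_subsets_card B derangements.
  rewrite (bigD1 B) /= ?powersetE // big_ord_recr /= binn mul1n addnC =>
    /addIn <-.
  apply: eq_bigr => C /andP[]; rewrite powersetE => CB CnB; apply: IH.
  by apply: leq_trans Ak; rewrite -BA proper_card // properEneq CnB.
have cI : #|[set: 'I_#|A|]| = #|A| by rewrite cardsT card_ord.
by have := split _ _ cI; rewrite (split _ A erefl) -derE => /addIn.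
Qed.

Lemma sum_derangements n : \sum_(j < n.+1) 'C(n, j) * derangements j = n`!.
Proof.
have := sum_perms_moving [set: 'I_n]; rewrite cardsT card_ord => <-.
rewrite (eq_bigr (fun B : {set 'I_n} => derangements #|B|)) => [|B _].
  by rewrite sum_subsets_card cardsT card_ord.
exact: perms_moving_card.
Qed.

(** The system is triangular, since v^_k vanishes for v < k and is k! for v = k; it is solved from v
    = n downwards. *)
Lemma ffact_moments_inj n (f g : nat -> nat) :
  (forall k, k <= n ->
    \sum_(v < n.+1) f v * v ^_ k = \sum_(v < n.+1) g v * v ^_ k) ->
  forall v, v <= n -> f v = g v.
Proof.
move=> fg v; have [k] := ubnP (n - v); elim: k v => // k IH v nv vn.
have vn' : v < n.+1 by [].
have := fg v vn; rewrite (bigD1 (Ordinal vn')) //= [RHS](bigD1 (Ordinal vn'))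
  //=.
have -> : \sum_(i < n.+1 | i != Ordinal vn') f i * i ^_ v =
          \sum_(i < n.+1 | i != Ordinal vn') g i * i ^_ v.
  apply: eq_bigr => i; rewrite -val_eqE /= => iv.
  have [ltiv|leiv] := ltnP i v; first by rewrite ffact_small // !muln0.
  have lvi : v < i by rewrite ltn_neqAle eq_sym iv.
  by have iN := ltn_ord i; rewrite IH //; lia.
by move/addIn/eqP; rewrite eqn_pmul2r ?ffactnn ?fact_gt0 // => /eqP.
Qed.

(** The identity C(n, j) (n-j)^_k = n^_k C(n-k, j) reduces the moment to [sum_derangements] for n -
    k. *)
Lemma derangement_moments n k : k <= n ->
  \sum_(v < n.+1) ('C(n, n - v) * derangements (n - v)) * v ^_ k = n`!.
Proof.
move=> kn; rewrite (reindex_inj rev_ord_inj) /=.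
rewrite (eq_bigr (fun j : 'I_n.+1 => 'C(n, j) * derangements j * (n - j) ^_ k)).
  2: by move=> j _; rewrite subSS subKn // -ltnS.
rewrite (bigID (fun j : 'I_n.+1 => j < (n - k).+1)) /=.
rewrite [X in _ + X]big1 ?addn0; last first.
  move=> j nj; rewrite ffact_small ?muln0 //.
  by have := ltn_ord j; lia.
rewrite -(big_ord_widen _ (fun j => 'C(n, j) * derangements j * (n - j) ^_ k));
  last by lia.
rewrite -(ffact_fact kn) -sum_derangements big_distrr /=; apply: eq_bigr => j _.
have jk : j + k <= n by have := ltn_ord j; lia.
have E : 'C(n, j) * (n - j) ^_ k = n ^_ k * 'C(n - k, j).
  apply/eqP; rewrite -(@eqn_pmul2r (j`! * (n - k - j)`!)) ?muln_gt0 ?fact_gt0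
    //.
  rewrite -[n ^_ k * _ * _]mulnA bin_fact ?ffact_fact //; last by lia.
  rewrite mulnACA subnAC ffact_fact; last by lia.
  by rewrite -mulnA bin_fact //; lia.
by rewrite mulnAC E -!mulnA.
Qed.

End Derangements.

(** * Spectra of one-parameter families of matrices *)

Lemma horner_alg_mx (K : comNzRingType) N (M : 'M[K]_N.+1) p :
  horner_alg M p = horner_mx M p.
Proof.
elim/poly_ind: p => [|p c IH]; first by rewrite !rmorph0.
rewrite !rmorphD !rmorphM /= IH horner_algX horner_algC horner_mx_X horner_mx_C.
by rewrite scalemx1.
Qed.

Lemma horner_mx_tr (K : comNzRingType) N (M : 'M[K]_N.+1) p :
  horner_mx M^T p = (horner_mx M p)^T.
Proof.
elim/poly_ind: p => [|p c IH]; first by rewrite !rmorph0 trmx0.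
rewrite !rmorphD !rmorphM /= IH !horner_mx_X !horner_mx_C.
rewrite linearD /= tr_scalar_mx; congr (_ + _).
rewrite -[LHS]trmx_mul; congr _^T.
by have := comm_horner_mx2 M 'X p; rewrite horner_mx_X.
Qed.

Lemma char_poly_similar (F : fieldType) N (P M D : 'M[F]_N) : P \in unitmx ->
  P *m M = D *m P -> char_poly M = char_poly D.
Proof.
move=> Pu PM; pose P' := map_mx polyC P.
have P'0 : \det P' != 0.
  by rewrite det_map_mx polyC_eq0 -unitfE -unitmxE.
apply: (mulfI P'0); rewrite /char_poly [RHS]mulrC -!det_mulmx /char_poly_mx.
rewrite mulmxBl mulmxBr -!map_mxM PM; congr (\det (_ - _)).
by rewrite scalar_mxC.
Qed.

Section SplitSpectrum.

Variables (F : fieldType) (N : nat) (M : 'M[F]_N.+1) (s : seq nat)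
  (c : nat -> F).
Hypotheses (cs : uniq (map c s))
  (Ms : horner_mx M (\prod_(i <- s) ('X - (c i)%:P)) = 0).

Lemma diagonalizable_split : diagonalizable M.
Proof.
apply/diagonalizableP; exists (map c s) => //.
by apply: mxminpoly_min; rewrite big_map.
Qed.

(** The function [e] records which root stands at each diagonal place. Keeping the index rather than
    the eigenvalue allows the multiplicities to be carried from one q to another. *)
Lemma split_spectrum : exists2 e : 'I_N.+1 -> nat, forall i, e i \in s &
  char_poly M = \prod_i ('X - (c (e i))%:P) /\
  forall p, \tr (horner_mx M p) = \sum_i p.[c (e i)].
Proof.
have [P Pu /diagonalizable_forPex[d /(simmxP Pu) PM]] := diagonalizable_split.
have hP p : P *m horner_mx M p *m invmx P = diag_mx (map_mx (horner p) d).
  by rewrite -horner_mx_diag -horner_mx_uconj // PM mulmxK.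
have dE i : exists2 k, k \in s & d 0 i = c k.
  have := hP (\prod_(i <- s) ('X - (c i)%:P)); rewrite Ms mulmx0 mul0mx.
  move=> /matrixP/(_ i i)/esym/eqP; rewrite !mxE eqxx mulr1n horner_prod.
  rewrite prodf_seq_eq0 => /hasP[k ks]; rewrite hornerXsubC subr_eq0 => /eqP ->.
  by exists k.
have [e es eE] := fin_all_exists2 dE; exists e => //; split=> [|p].
  rewrite (char_poly_similar Pu PM) char_poly_trig ?diag_mx_is_trig //.
  by apply: eq_bigr => i _; rewrite mxE eqxx eE.
rewrite -[horner_mx M p](mulKmx Pu) mxtrace_mulC hP mxtrace_diag.
by apply: eq_bigr => i _; rewrite mxE eE.
Qed.

End SplitSpectrum.

Lemma coef_qintX (K : nzRingType) i j : (qint 'X i : {poly K})`_j =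
  (j < i)%N%:R.
Proof.
have -> : qint 'X i = \poly_(j < i) (1 : K).
  by rewrite poly_def; apply: eq_bigr => k _; rewrite scale1r.
by rewrite coef_poly; case: ifP.
Qed.

Lemma qintX_inj (K : nzRingType) : injective (fun i => qint 'X i : {poly K}).
Proof.
move=> i j /= ij.
have natb (b c : bool) : b%:R = c%:R :> K -> b = c.
  by case: b; case: c => //= /eqP;
    rewrite mulr0n mulr1n ?oner_eq0 // eq_sym oner_eq0.
have H k : ((k < i) = (k < j))%N by apply: natb; rewrite -!coef_qintX ij.
by apply/eqP; rewrite eqn_leq leqNgt H ltnn leqNgt -H ltnn.
Qed.

Lemma horner_qintX (K : comNzRingType) (q : K) i : (qint 'X i).[q] = qint q i.
Proof.
by rewrite /qint horner_sum; apply: eq_bigr => k _; rewrite hornerXn.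
Qed.

Lemma qint1 (K : nzRingType) i : qint 1 i = i%:R :> K.
Proof.
by rewrite /qint (eq_bigr (fun=> 1)) ?sumr_const ?card_ord // => k _;
  rewrite expr1n.
Qed.

Lemma ffact_prod_sub (K : nzRingType) a k :
  (a ^_ k)%:R = \prod_(j <- iota 0 k) (a%:R - j%:R) :> K.
Proof.
elim: k => [|k IH]; first by rewrite big_nil.
rewrite -[k.+1]addn1 iotaD big_cat /= big_seq1 -IH addn1 ffactnSr natrM.
have [ka|ak] := leqP k a; first by rewrite natrB.
by rewrite ffact_small // !mul0r.
Qed.

Lemma map_prod_XsubC (K L : nzRingType) (f : {rmorphism K -> L})
    (I : Type) (r : seq I) (P : pred I) (c : I -> K) :
  map_poly f (\prod_(i <- r | P i) ('X - (c i)%:P)) =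
  \prod_(i <- r | P i) ('X - (f (c i))%:P).
Proof. by rewrite rmorph_prod; apply: eq_bigr => i _;
  rewrite /= map_polyXsubC. Qed.

Section Family.

Variables (K : idomainType) (N : nat) (M : 'M[{poly K}]_N.+1) (s : seq nat).
Hypotheses (us : uniq s)
  (Ms : horner_mx M (\prod_(i <- s) ('X - (qint 'X i)%:P)) = 0).

(** Over the fraction field of [{poly K}] the q-integers of an indeterminate are distinct, so the
    matrix splits there; both identities descend because [{poly K}] embeds in that field. *)
Lemma family_spectrum : exists2 e : 'I_N.+1 -> nat, forall i, e i \in s &
  char_poly M = \prod_i ('X - (qint 'X (e i))%:P) /\
  forall p, \tr (horner_mx M p) = \sum_i p.[qint 'X (e i)].
Proof.
pose f : {rmorphism {poly K} -> {fraction {poly K}}} := @tofrac _.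
have finj : injective f by move=> x y /eqP; rewrite tofrac_eq => /eqP.
have Fs : horner_mx (map_mx f M) (\prod_(i <- s) ('X - (f (qint 'X i))%:P)) = 0.
  by rewrite -[RHS](map_mx0 f) -Ms map_horner_mx map_prod_XsubC.
have uf : uniq (map (fun i => f (qint 'X i)) s).
  by rewrite map_inj_uniq // => i j /finj; apply: qintX_inj.
have [e es [eM eT]] := split_spectrum uf Fs; exists e => //; split=> [|p].
  apply: (map_inj_poly finj (rmorph0 f)).
  by rewrite map_char_poly eM map_prod_XsubC.
apply: finj; rewrite -trace_map_mx map_horner_mx eT rmorph_sum.
by apply: eq_bigr => i _; rewrite horner_map.
Qed.

End Family.

Lemma shuffle_roots_uniq n : uniq (shuffle_roots n).
Proof.
rewrite /= iota_uniq mem_iota andbT.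
by case: n => // k; rewrite ltnNge leqnSn.
Qed.

Lemma shuffle_roots_leq n i : i \in shuffle_roots n -> (i <= n)%N.
Proof. by rewrite inE mem_iota => /orP[/eqP ->|] //; case: n => // k; lia. Qed.

(** The multiplicities come from the indeterminate q and serve for every specialization, even where
    roots collide. At q = 1 the roots are integers, and the given traces are the falling-factorial
    moments that determine the multiplicities. *)
Lemma family_char_poly (K : numFieldType) n N (M : 'M[{poly K}]_N.+1) :
  horner_mx M (\prod_(i <- shuffle_roots n) ('X - (qint 'X i)%:P)) = 0 ->
  (forall k, (k <= n)%N ->
     \tr (horner_mx (map_mx (horner_eval 1) M)
            (\prod_(j <- iota 0 k) ('X - (qint 1 j)%:P))) = n`!%:R) ->
  forall q, char_poly (map_mx (horner_eval q) M) = chi n q.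
Proof.
move=> M0 tM q.
have [e es [eM eT]] := family_spectrum (shuffle_roots_uniq n) M0.
have en i : (e i < n.+1)%N by rewrite ltnS shuffle_roots_leq.
pose mult v := #|[pred i | e i == v]|.
have sumE (g : nat -> nat) : (\sum_i g (e i) = \sum_(v < n.+1) mult v * g v)%N.
  rewrite (partition_big (fun i => Ordinal (en i)) xpredT) //=.
  apply: eq_bigr => v _; rewrite (eq_bigr (fun=> g v)) => [|i /eqP <- //].
  by rewrite sum_nat_const.
have prodE (g : nat -> {poly K}) :
    \prod_i g (e i) = \prod_(v < n.+1) g v ^+ mult v.
  rewrite (partition_big (fun i => Ordinal (en i)) xpredT) //=.
  apply: eq_bigr => v _; rewrite (eq_bigr (fun=> g v)) => [|i /eqP <- //].
  by rewrite prodr_const.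
have multE : forall v, (v <= n)%N -> mult v =
  ('C(n, n - v) * derangements (n - v))%N.
  apply: ffact_moments_inj => k kn;
    rewrite derangement_moments // -(sumE (fun v => v ^_ k)%N).
  (* Characteristic zero turns an equality of traces in [K] into one of natural numbers. *)
  apply/eqP; rewrite -(Num.Theory.eqr_nat K) -(tM k kn); apply/eqP.
  have -> : \prod_(j <- iota 0 k) ('X - (qint 1 j)%:P) =
     map_poly (horner_eval 1) (\prod_(j <- iota 0 k)
       ('X - (qint 'X j : {poly K})%:P)).
    by rewrite map_prod_XsubC; apply: eq_bigr => j _;
      rewrite /= /horner_eval horner_qintX.
  rewrite -map_horner_mx trace_map_mx eT natr_sum [RHS]rmorph_sum.
  apply: eq_bigr => i _; rewrite horner_prod rmorph_prod ffact_prod_sub.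
  apply: eq_bigr => j _.
  by rewrite hornerXsubC /= /horner_eval hornerD hornerN !horner_qintX !qint1.
rewrite -map_char_poly eM map_prod_XsubC.
rewrite (eq_bigr (fun i => 'X - (qint q (e i))%:P)) => [|i _]; last first.
  by rewrite /= /horner_eval horner_qintX.
rewrite (prodE (fun v => 'X - (qint q v)%:P)) (reindex_inj rev_ord_inj) /=.
apply: eq_bigr => j _; rewrite subSS multE ?leq_subr // subKn //.
by rewrite -ltnS.
Qed.

(** * Semisimplicity *)

(** Write 1 = ax + z with z in a complement J of the left ideal Ax. Then x - xax = xz lies both in
    Ax and in J, so it is 0. *)
Lemma semisimple_regular (A : nzRingType) (x : A) :
  semisimple A -> exists a, x = x * a * x.
Proof.
move=> ssA; pose I y := exists a, y = a * x.
have idI : left_ideal I.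
  split=> [|_ _ [a ->] [b ->]|a _ [b ->]]; first by exists 0; rewrite mul0r.
    by exists (a + b); rewrite mulrDl.
  by exists (a * b); rewrite mulrA.
have [J [[J0 JD JM] IJ0 IJ]] := ssA I idI.
have [_ [z [[a ->] Jz E]]] := IJ 1.
exists a; apply/eqP; rewrite -subr_eq0 -mulrA.
have xz : x - x * (a * x) = x * z.
  by rewrite -{1}[x]mulr1 E mulrDr addrC addKr.
apply/eqP/IJ0; last by rewrite xz; apply: JM.
by exists (1 - x * a); rewrite mulrBl mul1r mulrA.
Qed.

Lemma hecke_ind (K : comNzRingType) n (q : K) (P : hecke n q -> Prop) :
  P 0 -> P 1 -> (forall i, (i < n.-1)%N -> P (hecke_gen n q i)) ->
  (forall x y, P x -> P y -> P (x + y)) ->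
    (forall x y, P x -> P y -> P (x * y)) ->
  (forall c x, P x -> P (c *: x)) -> forall x, P x.
Proof.
move=> P0 P1 Pg PD PM PZ; apply: hecke_piW; elim=> //.
- by move=> i; rewrite -[hecke_pi _ _]/(heckeT q i) -hecke_genE; apply: Pg.
- move=> u Pu; rewrite -hecke_pi_opp.
  have -> : hecke_opp (hecke_pi q u) = -1 *: hecke_pi q u by rewrite scaleN1r.
  exact: PZ.
- by move=> u Pu v Pv; rewrite -hecke_pi_add; apply: PD.
- by move=> u Pu v Pv; rewrite -hecke_pi_mul; apply: PM.
by move=> c u Pu; rewrite -hecke_pi_scale; apply: PZ.
Qed.

Section ShuffleMorphism.

Variables (K : comNzRingType) (A A' : algType K) (f : {rmorphism A -> A'}).
Variables (m : nat) (g : nat -> A) (g' : nat -> A').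
Hypothesis fg : forall i, (i < m)%N -> f (g i) = g' i.

Lemma rmorph_shuffle n : (n <= m.+1)%N -> f (shuffle g n) = shuffle g' n.
Proof.
elim: n => [|[|n] IH] nm; rewrite /= ?mulr0 ?addr0 ?rmorph0 ?rmorph1 //.
by rewrite rmorphD rmorphM rmorph1 fg // IH // ltnW.
Qed.

Lemma rmorph_coshuffle n : (n <= m.+1)%N -> f (coshuffle g n) = coshuffle g' n.
Proof.
elim: n => [|[|n] IH] nm; rewrite /= ?mul0r ?addr0 ?rmorph0 ?rmorph1 //.
by rewrite rmorphD rmorphM rmorph1 fg // IH // ltnW.
Qed.

Lemma rmorph_shuffle_prod n k : (n <= m.+1)%N ->
  f (shuffle_prod g n k) = shuffle_prod g' n k.
Proof.
elim: n k => [|n IH] [|k] nm; rewrite /= ?rmorph1 //.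
rewrite rmorphM (IH k (ltnW nm)); congr (_ * _).
exact: (rmorph_shuffle (n := n.+1)).
Qed.

End ShuffleMorphism.

Section SemisimpleHecke.

Variables (K : fieldType) (n : nat) (q : K).
Hypothesis ss : semisimple (hecke n q).

Lemma reg_rep_gen k : (k < n.-1)%N -> reg_rep (hecke_gen n q k) =
  reg_gen n.-1 q k.
Proof. exact: hecke_morph_gen. Qed.

(** The symmetrizer x is nonzero and satisfies Hx = Kx, so x = xax forces x^2 to be nonzero, whereas
    x^2 is [1]_q ... [n]_q times x. *)
Lemma semisimple_qint k : (0 < k <= n)%N -> qint q k != 0.
Proof.
pose x := shuffle_prod (hecke_gen n q) n n.
have nm : (n <= n.-1.+1)%N by rewrite leqSpred.
have x0 : x != 0.
  apply/eqP=> /(congr1 (fun y => reg_rep y (perm_rank 1) (perm_rank 1))).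
  rewrite (rmorph_shuffle_prod reg_rep_gen) // shuffle_prod_coef1 // rmorph0
    mxE.
  by move/eqP; rewrite oner_eq0.
have ax a : exists c, a * x = c *: x.
  move: a; apply: hecke_ind =>
    [||i im|a b [c ac] [d bd]|a b [c ac] [d bd]|c a [d ad]].
  - by exists 0; rewrite mul0r scale0r.
  - by exists 1; rewrite mul1r scale1r.
  - by exists q; rewrite (gen_symmetrizer (hecke_genP n q)) //; lia.
  - by exists (c + d); rewrite mulrDl ac bd scalerDl.
  - by exists (d * c); rewrite -mulrA bd -scalerAr ac scalerA.
  - by exists (c * d); rewrite -scalerAl ad scalerA.
have [a xax] := semisimple_regular x ss.
have [c ac] := ax a.
have xx : x * x != 0.
  by apply: contra x0 => /eqP xx; rewrite xax -mulrA ac -scalerAr xx scaler0.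
case: k => // k kn; apply: contra xx => /eqP k0.
rewrite /x (symmetrizer_square (hecke_genP n q)) // (bigD1 (Ordinal kn)) //= k0.
by rewrite mul0r scale0r.
Qed.

(* At q = 0 the negatives of the generators are idempotents satisfying the    *)
(* braid relations.                                                           *)
Let upper_gen (i : nat) : 'M[K]_2 :=
  if i == 0%N then - delta_mx 0 0 else
  if i == 1%N then - (delta_mx 0 1 + delta_mx 1 1) else 0.

Lemma upper_genP m : hecke_gens 0 m upper_gen.
Proof.
split.
- case=> [|[|i]] _; rewrite sub0r scaleN1r scale0r addr0 /upper_gen /=.
  + by rewrite mulrNN opprK -[LHS]/(_ *m _) mul_delta_mx.
  + rewrite mulrNN opprK -[LHS]/(_ *m _) mulmxDl !mulmxDr.
    by rewrite !mul_delta_mx_cond /= !mulr0n !mulr1n !add0r.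
  + by rewrite mulr0 oppr0.
- by move=> [|i] [|[|j]] // _ _; rewrite /upper_gen /= mulr0 mul0r.
case=> [|[|i]] _; rewrite /upper_gen /= ?(mulr0, mul0r) //.
have e0 : (delta_mx 0 1 + delta_mx 1 1) * delta_mx 0 0 = 0 :> 'M[K]_2.
  by rewrite -[LHS]/(_ *m _) mulmxDl !mul_delta_mx_cond /= !mulr0n addr0.
by rewrite !mulNr !mulrN e0 mulNr -mulrA e0 mulr0 oppr0 mul0r.
Qed.

(** For n >= 3 the algebra at q = 0 maps to upper triangular 2 by 2 matrices, and the commutator x
    of the first two generators is sent to the strictly upper triangular unit. The image of any xax
    is then 0, which contradicts [semisimple_regular]. *)
Lemma semisimple_q0 : q = 0 -> (n <= 2)%N.
Proof.
move=> q0; rewrite leqNgt; apply/negP => n3.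
have gP : hecke_gens q n.-1 upper_gen by rewrite q0; apply: upper_genP.
pose f : hecke n q -> 'M[K]_2 := hecke_morph gP.
have fD x y : f (x + y) = f x + f y by apply: rmorphD.
have fM x y : f (x * y) = f x *m f y by apply: rmorphM.
have fg i : (i < n.-1)%N -> f (hecke_gen n q i) =
  upper_gen i by apply: hecke_morph_gen.
have up a : f a 1 0 = 0.
  move: a; apply: hecke_ind => [||i im|a b a0 b0|a b a0 b0|c a a0].
  - by rewrite [f 0]rmorph0 mxE.
  - by rewrite [f 1]rmorph1 mxE.
  - rewrite fg // /upper_gen; case: eqP => _; [|case: eqP => _];
    rewrite !mxE //=.
      by rewrite oppr0.
    by rewrite addr0 oppr0.
  - by rewrite fD mxE a0 b0 addr0.
  - by rewrite fM mxE !big_ord_recl big_ord0 /= a0 mul0r add0r addr0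
    [X in _ * f b X _](_ : _ = 1) ?b0 ?mulr0 //; apply/val_inj.
  - by rewrite [f _]linearZ /= mxE [X in _ * X]a0 mulr0.
set T0 := hecke_gen n q 0; set T1 := hecke_gen n q 1.
have [a xax] := semisimple_regular (T0 * T1 - T1 * T0) ss.
have fx : f (T0 * T1 - T1 * T0) = delta_mx 0 1.
  rewrite [f _]rmorphB !rmorphM /= -/f [_ T0]fg ?[_ T1]fg; try lia.
  rewrite /upper_gen /= !mulrNN -![_ * _]/(_ *m _) mulmxDl mulmxDr.
  by rewrite !mul_delta_mx_cond /= !mulr0n !mulr1n !addr0 subr0.
have := congr1 f xax; rewrite !fM fx.
have -> : delta_mx 0 1 *m f a *m delta_mx 0 1 = 0 :> 'M[K]_2.
  apply/matrixP => i j; rewrite !mxE big_ord_recl big_ord_recl big_ord0 !mxE.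
  rewrite !big_ord_recl !big_ord0 !mxE /= ?(mul0r, mulr0, add0r, addr0).
  have -> : f a (lift ord0 ord0) ord0 = 0.
    by rewrite -(up a); congr (fun_of_matrix _ _ _); apply/val_inj.
  have -> : (ord0 == 1 :> 'I_2) = false by [].
  by rewrite andbF mulr0 mul0r addr0 mul0r.
move=> /matrixP/(_ 0 1); rewrite !mxE !eqxx => /eqP.
by rewrite oner_eq0.
Qed.

End SemisimpleHecke.

Lemma qintD (K : nzRingType) (q : K) a b :
  qint q (a + b) = qint q a + q ^+ a * qint q b.
Proof.
rewrite /qint big_split_ord /= big_distrr /=; congr (_ + _).
by apply: eq_bigr => i _; rewrite exprD.
Qed.

(** For i < j the difference [j]_q - [i]_q is q^i [j-i]_q, whose second factor is nonzero. The first
    vanishes only if q = 0 and i > 0; then n <= 2, and the list contains no two positive roots. *)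
Lemma semisimple_uniq_roots (K : fieldType) n (q : K) :
  semisimple (hecke n q) -> uniq (map (qint q) (shuffle_roots n)).
Proof.
move=> ss; have H i j : i \in shuffle_roots n -> j \in shuffle_roots n ->
  (i < j)%N ->
    qint q i <> qint q j.
  move=> ir jr ij; have jn := shuffle_roots_leq jr.
  rewrite -(subnKC (ltnW ij)) qintD => /eqP.
  rewrite -subr_eq0 opprD addrA subrr add0r oppr_eq0.
  rewrite mulf_eq0 (negPf (semisimple_qint ss _)) ?orbF; last by lia.
  rewrite expf_eq0 => /andP[i0 /eqP q0]; have n2 := semisimple_q0 ss q0.
  move: ir; rewrite inE mem_iota => /orP[/eqP iE|]; first by lia.
  by case: (n) n2 => [|[|[|k]]] //; lia.
rewrite map_inj_in_uniq ?shuffle_roots_uniq // => i j ir jr ij.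
by case: (ltngtP i j) => // lij; [have := H i j|have := H j i] => /(_ _ _ lij);
  case.
Qed.

(** * Spectra of the two shuffles and the theorem *)

Section Spectrum.

Variables (K : numFieldType) (n : nat).

Notation m := n.-1.
Notation N := ((m.+1)`!.-1).

Let fact_n : (m.+1)`! = n`!.
Proof. by case: (n). Qed.

Let leq_n : (n <= m.+1)%N.
Proof. exact: leqSpred. Qed.

Lemma horner_shuffle_roots (L : comNzRingType) (q : L) :
  horner_mx (shuffle (reg_gen m q) n)
    (\prod_(i <- shuffle_roots n) ('X - (qint q i)%:P)) = 0.
Proof. by rewrite -horner_alg_mx;
  apply: shuffle_annihilated (reg_genP m q) _ _. Qed.

Lemma horner_coshuffle_roots (L : comNzRingType) (q : L) :
  horner_mx (coshuffle (reg_gen m q) n)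
    (\prod_(i <- shuffle_roots n) ('X - (qint q i)%:P)) = 0.
Proof.
rewrite coshuffle_reg_gen horner_mx_tr -horner_alg_mx.
by rewrite (shuffle_annihilated (reg_gen_trP m q)) // trmx0.
Qed.

Lemma tr_horner_shuffle1 k : (k <= n)%N ->
  \tr (horner_mx (shuffle (reg_gen m 1) n)
    (\prod_(j <- iota 0 k) ('X - (qint 1 j)%:P))) =
  n`!%:R :> K.
Proof.
move=> kn; rewrite -horner_alg_mx (shuffle_falling (reg_genP m 1)) //.
by rewrite expr1n scale1r tr_shuffle_prod // fact_n.
Qed.

(** Since the generators are symmetric at q = 1, the traces needed for B*_n are those already
    computed for B_n. *)
Lemma coshuffle_reg_gen1 :
  coshuffle (reg_gen m (1 : K)) n = (shuffle (reg_gen m 1) n)^T.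
Proof.
rewrite coshuffle_reg_gen; congr _^T.
suff E k : shuffle (fun j => (reg_gen m (1 : K) j)^T) k =
  shuffle (reg_gen m 1) k.
  exact: E.
by elim: k => //= k ->; rewrite reg_gen_tr.
Qed.

Lemma char_poly_shuffle (q : K) : char_poly (shuffle (reg_gen m q) n) = chi n q.
Proof.
have E (x : K) : map_mx (horner_eval x) (shuffle (reg_gen m 'X) n) =
  shuffle (reg_gen m x) n.
  by rewrite map_shuffle /= /horner_eval hornerX.
rewrite -E; apply: family_char_poly; first exact: horner_shuffle_roots.
by move=> k kn; rewrite E tr_horner_shuffle1.
Qed.

Lemma char_poly_coshuffle (q : K) : char_poly (coshuffle (reg_gen m q) n) =
  chi n q.
Proof.
have E (x : K) : map_mx (horner_eval x) (coshuffle (reg_gen m 'X) n) =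
  coshuffle (reg_gen m x) n.
  by rewrite map_coshuffle /= /horner_eval hornerX.
rewrite -E; apply: family_char_poly; first exact: horner_coshuffle_roots.
by move=> k kn; rewrite E coshuffle_reg_gen1 horner_mx_tr mxtrace_tr
  tr_horner_shuffle1.
Qed.

Lemma reg_rep_heckeB (q : K) : reg_rep (heckeB n q) = shuffle (reg_gen m q) n.
Proof. by rewrite heckeB_shuffle (rmorph_shuffle (@reg_rep_gen K n q)). Qed.

Lemma reg_rep_heckeBstar (q : K) : reg_rep (heckeBstar n q) =
  coshuffle (reg_gen m q) n.
Proof. by rewrite heckeBstar_coshuffle (rmorph_coshuffle (@reg_rep_gen K n q)).
  Qed.

End Spectrum.

Local Open Scope complex_scope.

Theorem theorem1p5 (R : realType) (n : nat) (q : R[i]) :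
  [/\ has_char_poly (rmul (heckeBstar n q)) (chi n q),
      has_char_poly (rmul (heckeB n q)) (chi n q)
    & semisimple (hecke n q) ->
      is_diagonalizable (rmul (heckeBstar n q)) /\
      is_diagonalizable (rmul (heckeB n q))].
Proof.
split.
- by rewrite -char_poly_coshuffle -reg_rep_heckeBstar;
  apply: has_char_poly_rmul.
- by rewrite -char_poly_shuffle -reg_rep_heckeB; apply: has_char_poly_rmul.
move=> ss; have ur := semisimple_uniq_roots ss.
split; apply: is_diagonalizable_rmul; apply: diagonalizable_split ur _.
- by rewrite reg_rep_heckeBstar horner_coshuffle_roots.
by rewrite reg_rep_heckeB horner_shuffle_roots.
Qed.
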